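(* Let $d\geq 2$ be an integer and let $d'$ be the smallest even integer greater than $d$. Let $f:\mathbb{R}^n\to\mathbb{R}$ be $d$ times continuously differentiable and strongly convex, i.e. there exists $\mu>0$ such that $\nabla^2 f(x)\succeq\mu I$ for all $x\in\mathbb{R}^n$. Let $g_1,\dots,g_m:\mathbb{R}^n\to\mathbb{R}$ be SOS-convex polynomials such that $C:=\{x\in\mathbb{R}^n:g_i(x)\leq 0,\ i=1,\dots,m\}$ has nonempty interior, and let $x^\ast\in C$ be the unique minimizer of $f$ over $C$. For $x\in C$ let $I(x):=\{i\in\{1,\dots,m\}:g_i(x)=0\}$. Assume that the gradients $\{\nabla g_i(x^\ast)\}_{i\in I(x^\ast)}$ are linearly independent, and that the Lagrange multipliers $\lambda_1^\ast,\dots,\lambda_m^\ast\geq 0$ satisfying the KKT conditions $\nabla f(x^\ast)+\sum_{i=1}^m\lambda_i^\ast\nabla g_i(x^\ast)=0$ and $\lambda_i^\ast g_i(x^\ast)=0$ for all $i$ satisfy strict complementary slackness: $\lambda_i^\ast>0$ for every $i\in I(x^\ast)$. Then there exists a radius $r>0$ such that, for every $x\in\mathbb{R}^n$ satisfying $\|x-x^\ast\|\leq r$, the unique minimizer $x^+$ of $\psi_{x,d}$ over $C$ satisfies $I(x^+)=I(x^\ast)$.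
   Context: $\|\cdot\|$ denotes the Euclidean norm on $\mathbb{R}^n$. A polynomial is a sum of squares (SOS) if it is a finite sum of squares of real polynomials. A polynomial $p:\mathbb{R}^n\to\mathbb{R}$ is SOS-convex if the polynomial $(x,y)\mapsto\langle\nabla^2p(x)y,y\rangle$ on $\mathbb{R}^n\times\mathbb{R}^n$ is SOS. $T_{x,d}(y):=\sum_{k=0}^{d}\frac{1}{k!}\nabla^kf(x)[y-x,\dots,y-x]$ is the $d$th-order Taylor expansion of $f$ at $x$, where $\nabla^k f(x)$ is the symmetric tensor of $k$th-order partial derivatives, applied to $k$ copies of $y-x$. $t(x):=\min\{t\in\mathbb{R}: t\geq 0,\ y\mapsto T_{x,d}(y)+t\|y-x\|^{d'}\text{ is SOS-convex}\}$, and $\psi_{x,d}(y):=T_{x,d}(y)+t(x)\|y-x\|^{d'}$. *)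

(* Defs.v *)
From HB Require Import structures.
From mathcomp Require Import all_boot all_order all_algebra.
From mathcomp Require Import all_classical all_reals all_analysis.
(* The notations of mpoly clash with those of mathcomp-analysis. *)
From mathcomp.multinomials Require Import -(notations) mpoly.

Set Implicit Arguments.
Unset Strict Implicit.
Unset Printing Implicit Defensive.

Import Order.TTheory GRing.Theory Num.Theory.
Import numFieldNormedType.Exports.

Local Open Scope classical_set_scope.
Local Open Scope ring_scope.

Section Euclidean.
Context {R : realType} {n : nat}.
Implicit Types (A : 'M[R]_n) (F : 'rV[R]_n -> R) (C : set 'rV[R]_n).

(* The library norm on 'rV[R]_n is the sup norm (with the same topology). *)
Definition enorm (x : 'rV[R]_n) : R := Num.sqrt (\sum_i x 0 i ^+ 2).

(* Used only for Hessians of C^2 functions (minus scalar matrices), which are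
   symmetric by Schwarz's theorem, so symmetry is not part of the definition. *)
Definition psdmx A := forall v : 'rV[R]_n, 0 <= (v *m A *m v^T) 0 0.

Definition minimizer F C (x : 'rV[R]_n) := C x /\ forall y, C y -> F x <= F y.

Definition unique_minimizer F C (x : 'rV[R]_n) :=
  minimizer F C x /\ forall y, minimizer F C y -> y = x.

End Euclidean.

Section Smooth.
Context {R : realType} {n : nat}.
Implicit Types (f : 'rV[R]_n -> R) (x : 'rV[R]_n).

Definition partial f (s : seq 'I_n) : 'rV[R]_n -> R :=
  foldr (fun i h x => 'D_('e_i) h x) f s.

(* All partial derivatives of order at most d exist and are continuous. *)
Definition Cd (d : nat) f :=
  (forall s : seq 'I_n, (size s <= d)%N -> continuous (partial f s)) /\
  (forall (s : seq 'I_n) (i : 'I_n) x,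
     (size s < d)%N -> derivable (partial f s) x 'e_i).

Definition grad f x : 'rV[R]_n := \row_i partial f [:: i] x.

Definition hess f x : 'M[R]_n := \matrix_(i, j) partial f [:: i; j] x.

Definition strongly_convex f :=
  exists2 mu : R, 0 < mu & forall x, psdmx (hess f x - mu%:M).

End Smooth.

Section Polynomials.
Context {R : realType} {n : nat}.
Implicit Types (p q : mpoly n R) (x y : 'rV[R]_n).

Definition pvar (i : 'I_n) : mpoly n R := mpolyX R (mnm1 i).

Definition peval p x : R := meval (fun i => x 0 i) p.

Definition pgrad p x : 'rV[R]_n := \row_i peval (mderiv i p) x.

Definition sos p := exists s : seq (mpoly n R), p = \sum_(q <- s) q ^+ 2.

End Polynomials.

Section SosConvex.
Context {R : realType} {n : nat}.
Implicit Types (p : mpoly n R) (x y : 'rV[R]_n).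

(* The polynomial (x, y) |-> <Hess p(x) y, y> in n + n variables: the first n
   variables stand for x, the last n ones for y. *)
Definition hess_form p : mpoly (n + n) R :=
  \sum_(i < n) \sum_(j < n)
    comp_mpoly [tuple pvar (lshift n k) | k < n]
      (mderiv i (mderiv j p))
    * pvar (rshift n i) * pvar (rshift n j).

Definition sosconvex p := sos (hess_form p).

Lemma hess_formE p x y :
  peval (hess_form p) (row_mx x y) =
  (y *m (\matrix_(i, j) peval (mderiv i (mderiv j p)) x) *m y^T) 0 0.
Proof.
rewrite /peval /hess_form raddf_sum mxE.
under [RHS]eq_bigr => j _ do rewrite mxE mulr_suml.
rewrite [RHS]exchange_big; apply: eq_bigr => i _ /=.
rewrite raddf_sum; apply: eq_bigr => j _ /=.
rewrite !rmorphM /= !mevalXU comp_mpoly_meval !row_mxEr !mxE.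
congr (_ * _); rewrite mulrC; congr (_ * _).
by apply: meval_eq => k; rewrite tnth_mktuple mevalXU row_mxEl.
Qed.

End SosConvex.

Section Model.
Context {R : realType} {n : nat}.
Variables (f : 'rV[R]_n -> R) (d d' : nat) (x : 'rV[R]_n).

(* y_i - x_i, as a polynomial in y *)
Definition pshift (i : 'I_n) : mpoly n R := pvar i - mpolyC n (x 0 i).

(* The tensor nabla^k f(x) applied to k copies of y - x is the sum over all
   index tuples (i_1, ..., i_k). *)
Definition taylor : mpoly n R :=
  \sum_(k < d.+1) (k`!%:R)^-1 *:
    \sum_(s : k.-tuple 'I_n) partial f s x *: \prod_(i <- s) pshift i.

(* |y - x|^d' for even d' *)
Definition reg : mpoly n R := (\sum_i pshift i ^+ 2) ^+ d'./2.

Definition psi (t : R) : mpoly n R := taylor + t *: reg.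

Definition is_tmin (t : R) :=
  let S := [set t : R | 0 <= t /\ sosconvex (psi t)] in S t /\ lbound S t.

Lemma peval_reg y : ~~ odd d' -> peval reg y = enorm (y - x) ^+ d'.
Proof.
move=> ed; rewrite /peval /reg rmorphXn /= raddf_sum /=.
under eq_bigr => i _.
  rewrite rmorphXn /= rmorphB /= mevalXU mevalC; over.
rewrite -[in RHS](even_halfK ed) -muln2 mulnC exprM /enorm sqr_sqrtr.
  by congr (_ ^+ _); apply: eq_bigr => i _; rewrite !mxE.
by apply: sumr_ge0 => i _; rewrite sqr_ge0.
Qed.

Lemma peval_taylor y : peval taylor y =
  \sum_(k < d.+1) (k`!%:R)^-1 *
    \sum_(s : k.-tuple 'I_n) partial f s x * \prod_(i <- s) (y - x) 0 i.
Proof.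
rewrite /peval /taylor raddf_sum /=; apply: eq_bigr => k _.
rewrite mevalZ raddf_sum /=; congr (_ * _); apply: eq_bigr => s _.
rewrite mevalZ rmorph_prod /=; congr (_ * _); apply: eq_bigr => i _.
by rewrite rmorphB /= mevalXU mevalC !mxE.
Qed.

End Model.

Definition smallest_even_gt (d d' : nat) :=
  [/\ (d < d')%N, ~~ odd d' & forall e, (d < e)%N -> ~~ odd e -> (d' <= e)%N].

Section Constraints.
Context {R : realType} {n m : nat}.
Implicit Types (g : 'I_m -> mpoly n R) (x : 'rV[R]_n).

Definition feasible g : set 'rV[R]_n := [set x | forall i, peval (g i) x <= 0].

Definition active g x : {set 'I_m} := [set i | peval (g i) x == 0]%SET.

(* Linear independence of the family of active gradients. *)
Definition licq g x := free [seq pgrad (g i) x | i in active g x].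

End Constraints.

(* Main.v *)
(* The Hessian form of the Taylor model at x is <H v, v> plus monomials z^a v_i v_j with
   1 <= |a| <= d - 2, where z = y - x.  AM-GM dominates such a monomial by
   (1 + |z|^(d'-2)) |v|^2 modulo sums of squares, and rescaling z makes the coefficient of
   |v|^2 arbitrarily small, so that strong convexity pays for it and t |z|^(d'-2) |v|^2 for
   the rest.  Hence t(x) is bounded near x*, and the model is uniformly strongly convex on a
   fixed small ball; the minimum defining t(x) is attained because the cone of Gram matrices
   is closed.  As x -> x*, the gradient of the model at x* tends to that of f, and the KKT
   conditions confine its minimizer over C to an arbitrarily small ball around x*.
   Inactive constraints stay inactive there.  If an active g_i became slack at the minimizer
   x+, a direction u with <grad g_i, u> > 0 and <grad g_k, u> < 0 for the other active k (it
   exists by linear independence) would be feasible at x+ and, since lambda_i > 0, decrease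
   the model: so no convergence of multipliers is needed. *)

Require Import Defs.
From HB Require Import structures.
From mathcomp Require Import all_boot all_order all_algebra.
From mathcomp Require Import all_classical all_reals all_analysis.
From mathcomp.multinomials Require Import -(notations) mpoly.
From mathcomp Require Import ring lra zify.
From mathcomp.real_closed Require polyrcf.

Import Order.TTheory GRing.Theory Num.Theory.
Import numFieldNormedType.Exports.

Local Open Scope classical_set_scope.
Local Open Scope ring_scope.

(** * Sums of squares *)

(** The obstacle is that t(x) is defined by an SOS condition, so pointwise inequalities on the
    Hessian do not bound it: the bound needs an explicit certificate, uniform in x near x*. One
    certificate, [hess_dominated], serves twice. Adding K times the Hessian form of the regularizer
    proves that K is admissible for t(x), and evaluating it at points gives a convexity modulus of
    the model valid for every t >= 0. A bound on t(x) replaces continuity of t(x), because the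
    gradient of t |y - x|^d' is small near y = x uniformly for t in [0, K]. The radii are chosen
    from the inside out: the directions u depend on x* alone and fix how well the gradient must be
    approximated, which limits rho, the radius of the ball that must contain x+; then rho fixes the
    gradient accuracy required at x*, and finally r. *)

Section SumsOfSquares.
Context {R : realType} {k : nat}.
Local Notation A := (mpoly k R).
Local Notation "c %:C" := (@mpolyC k R c) (at level 2).
Implicit Types (p q : A) (c M : R).

Lemma sos0 : sos (0 : A).
Proof. by exists [::]; rewrite big_nil. Qed.

Lemma sosD p q : sos p -> sos q -> sos (p + q).
Proof. by move=> [s ->] [t ->]; exists (s ++ t); rewrite big_cat. Qed.

Lemma sos_sqr p : sos (p ^+ 2).
Proof. by exists [:: p]; rewrite big_seq1. Qed.

Lemma sos_sum I (r : seq I) (P : pred I) (F : I -> A) :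
  (forall i, P i -> sos (F i)) -> sos (\sum_(i <- r | P i) F i).
Proof. by move=> FP; elim/big_ind: _ => //; [exact: sos0 | exact: sosD]. Qed.

Lemma sosM p q : sos p -> sos q -> sos (p * q).
Proof.
move=> [s ->] [t ->]; rewrite mulr_suml; apply: sos_sum => a _.
by rewrite mulr_sumr; apply: sos_sum => b _; rewrite -exprMn; exact: sos_sqr.
Qed.

Lemma sosC c : 0 <= c -> sos c%:C.
Proof. by move=> c0; rewrite -(sqr_sqrtr c0) rmorphXn; exact: sos_sqr. Qed.

Lemma sosX p j : sos p -> sos (p ^+ j).
Proof.
move=> sp; elim: j => [|j IH]; first by rewrite expr0 -(expr1n _ 2); exact: sos_sqr.
by rewrite exprS; exact: sosM.
Qed.

Lemma sosZ c p : 0 <= c -> sos p -> sos (c *: p).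
Proof. by move=> c0 sp; rewrite -mul_mpolyC; exact/sosM/sp/sosC. Qed.

Lemma sosMn p j : sos p -> sos (p *+ j).
Proof. by move=> sp; rewrite -scaler_nat; apply: sosZ => //; rewrite ler0n. Qed.

(** Both factors are divisible by p - 1, so the product is the square of p - 1 times two geometric
    sums in p. *)
Lemma sos_geometric p a b : sos p -> sos ((p ^+ a - 1) * (p ^+ b - 1)).
Proof.
move=> sp; rewrite !subrX1.
rewrite (_ : _ * _ = (p - 1) ^+ 2 * ((\sum_(i < a) p ^+ i) * \sum_(i < b) p ^+ i));
  last by ring.
by apply: sosM; [exact: sos_sqr | apply: sosM; apply: sos_sum => i _; exact: sosX].
Qed.

(** For numbers this is a case split on p <= 1. The certificate replaces the split by the fact that
    p^j - 1 and p^(e-j) - 1 have the same sign, in the SOS form of [sos_geometric]. *)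
Lemma sos_subX p e j : (j <= e)%N -> sos p -> sos (1 + p ^+ e - p ^+ j).
Proof.
move=> je sp; rewrite (_ : _ - _ = (p ^+ j - 1) * (p ^+ (e - j) - 1) + p ^+ (e - j)).
  by apply: sosD; [exact: sos_geometric | exact: sosX].
by rewrite -{1}(subnKC je) exprD; ring.
Qed.

Lemma sos_amgm M c p q : `|c| <= M ->
  sos ((M / 2)%:C * (p ^+ 2 + q ^+ 2) + c%:C * (p * q)).
Proof.
rewrite ler_norml => /andP[cM Mc].
(* Spreading the cross term over both squares avoids a split on the sign of c: the two weights are
   nonnegative because |c| <= M. *)
rewrite (_ : _ + _ = ((M + c) / 4)%:C * (p + q) ^+ 2
                   + ((M - c) / 4)%:C * (p - q) ^+ 2).
  by apply: sosD; apply: sosM; rewrite ?sos_sqr//; first [exact: sos_sqr|apply: sosC; lra].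
have {1}-> : c = (M + c) / 4 * 2 - (M - c) / 4 * 2 by field.
have {1}-> : M / 2 = (M + c) / 4 + (M - c) / 4 by field.
ring.
Qed.

End SumsOfSquares.

(** * SOS domination of monomials *)

Section Domination.
Context {R : realType} {n k : nat}.
Local Notation A := (mpoly k R).
Local Notation "c %:C" := (@mpolyC k R c) (at level 2).
Implicit Types (Z V : 'I_n -> A) (s : seq 'I_n) (c M eps : R).

Definition sqs Z : A := \sum_i Z i ^+ 2.

Lemma sos_sqs Z : sos (sqs Z).
Proof. by apply: sos_sum => i _; exact: sos_sqr. Qed.

Lemma sos_sqs_sub Z i : sos (sqs Z - Z i ^+ 2).
Proof.
rewrite /sqs (bigD1 i)//= addrAC subrr add0r.
by apply: sos_sum => j _; exact: sos_sqr.
Qed.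

Lemma sos_sqs_mono Z s : sos (sqs Z ^+ size s - (\prod_(i <- s) Z i) ^+ 2).
Proof.
elim: s => [|i s IH] /=; first by rewrite big_nil expr1n subrr; exact: sos0.
rewrite big_cons exprMn exprS.
set S := sqs Z; set P := \prod_(j <- s) Z j.
rewrite (_ : _ - _ = (S - Z i ^+ 2) * S ^+ size s
                   + Z i ^+ 2 * (S ^+ size s - P ^+ 2)); last by ring.
apply: sosD; apply: sosM => //; [exact: sos_sqs_sub| |exact: sos_sqr].
exact/sosX/sos_sqs.
Qed.

Lemma sos_mono_le Z V e s i : (size s <= e)%N ->
  sos ((1 + sqs Z ^+ e) * sqs V - ((\prod_(a <- s) Z a) * V i) ^+ 2).
Proof.
move=> se; set P := \prod_(a <- s) Z a.
rewrite (_ : _ - _ = (1 + sqs Z ^+ e - sqs Z ^+ size s) * sqs V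
  + (sqs Z ^+ size s - P ^+ 2) * sqs V + P ^+ 2 * (sqs V - V i ^+ 2));
  last by ring.
apply: sosD; last by apply: sosM; [exact: sos_sqr|exact: sos_sqs_sub].
apply: sosD; apply: sosM; try exact: sos_sqs; last exact: sos_sqs_mono.
by apply: sos_subX => //; exact: sos_sqs.
Qed.

(** Cutting the word s after e letters writes the monomial as (P V_i)(Q V_j) with P and Q of degree
    at most e; AM-GM then only involves the squares of the two factors, each below (1 + |Z|^(2e))
    |V|^2. *)
Lemma sos_mono Z V e s i j M c : (size s <= e.*2)%N -> `|c| <= M ->
  sos (M%:C * ((1 + sqs Z ^+ e) * sqs V) + c%:C * ((\prod_(a <- s) Z a) * V i * V j)).
Proof.
move=> se cM; have M0 : 0 <= M by exact: le_trans cM.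
rewrite -(cat_take_drop e s) big_cat/=.
have := sos_mono_le Z V e (take e s) i; have := sos_mono_le Z V e (drop e s) j.
set P := \prod_(a <- take e s) Z a; set Q := \prod_(a <- drop e s) Z a.
move=> sQ sP.
have {}sQ : sos ((1 + sqs Z ^+ e) * sqs V - (Q * V j) ^+ 2).
  by apply: sQ; rewrite size_drop; lia.
have {}sP : sos ((1 + sqs Z ^+ e) * sqs V - (P * V i) ^+ 2).
  by apply: sP; rewrite size_take; case: ltnP; lia.
rewrite (_ : _ + _ = (M / 2)%:C * ((1 + sqs Z ^+ e) * sqs V - (Q * V j) ^+ 2)
  + (M / 2)%:C * ((1 + sqs Z ^+ e) * sqs V - (P * V i) ^+ 2)
  + ((M / 2)%:C * ((P * V i) ^+ 2 + (Q * V j) ^+ 2) + c%:C * (P * V i * (Q * V j)))).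
  apply: sosD; last exact: sos_amgm.
  by apply: sosD; apply: sosM => //; apply: sosC; lra.
have {1}-> : M = M / 2 + M / 2 by field.
ring.
Qed.

(** [K] is chosen before [c], [Z] and [V], so one constant serves all base points x whose Taylor
    coefficients are bounded by [M]. *)
Definition dominated e (w : ('I_n -> A) -> ('I_n -> A) -> A) :=
  forall M eps, 0 < eps -> exists2 K, 0 <= K & forall c Z V, `|c| <= M ->
  sos ((eps%:C + K%:C * sqs Z ^+ e) * sqs V + c%:C * w Z V).

Lemma sqsZ c Z : sqs (fun a => c%:C * Z a) = c%:C ^+ 2 * sqs Z.
Proof. by rewrite /sqs mulr_sumr; apply: eq_bigr => a _; rewrite exprMn. Qed.

(* The monomial has degree at least 1 in Z, so that applying sos_mono to a large
   multiple of Z makes the coefficient of |V|^2 small. *)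
Lemma dominated_mono e s i j : (0 < size s <= e.*2)%N ->
  dominated e (fun Z V => (\prod_(a <- s) Z a) * V i * V j).
Proof.
move=> /andP[s0 se] M eps eps0.
have [M0|M0] := ltP M 0.
  by exists 0 => // c Z V /le_lt_trans /(_ M0); rewrite normr_lt0.
(* Substituting l Z multiplies the monomial by l^(size s). Dividing by this power leaves M / l^(size
   s) in front of |V|^2, at most M / l <= eps since s is nonempty and eps * l >= M. *)
pose l := 1 + M / eps; have l1 : 1 <= l by rewrite lerDl divr_ge0// ltW.
have l0 : 0 < l by apply: lt_le_trans l1.
have ls0 : 0 < l ^+ size s by rewrite exprn_gt0.
exists (M * l ^+ e.*2 / l ^+ size s).
  by rewrite mulr_ge0 ?invr_ge0 ?mulr_ge0 ?exprn_ge0// ltW.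
move=> c Z V cM.
have := sos_mono (fun a => l%:C * Z a) V e s i j M c se cM.
rewrite sqsZ big_split/= -{1}(map_id s) big_map.
rewrite (_ : \prod_(a <- s) l%:C = (l ^+ size s)%:C); last first.
  by rewrite big_const_seq count_predT iter_mulr_1 rmorphXn.
set P := \prod_(a <- s) Z a => sb.
have Ml : M * (l ^+ size s)^-1 <= eps.
  rewrite ler_pdivrMr//; apply: (@le_trans _ _ (eps * l)).
    by rewrite /l mulrDr mulr1 mulrCA divff ?gt_eqF// mulr1 lerDr ltW.
  by rewrite ler_pM2l// -{1}(expr1 l) ler_weXn2l.
rewrite (_ : _ + _ = ((l ^+ size s)^-1)%:C *
  (M%:C * ((1 + (l%:C ^+ 2 * sqs Z) ^+ e) * sqs V) +
        c%:C * ((l ^+ size s)%:C * P * V i * V j))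
  + (eps - M * (l ^+ size s)^-1)%:C * sqs V).
  apply: sosD; apply: sosM => //; try exact: sos_sqs; apply: sosC.
    by rewrite invr_ge0 ltW.
  by rewrite subr_ge0.
have e1 : ((l ^+ size s)^-1)%:C * (l ^+ size s)%:C = 1.
  by rewrite -rmorphM/= mulVf ?gt_eqF// rmorph1.
rewrite exprMn -exprM mul2n !rmorphM rmorphB/= rmorphM rmorphXn/=.
set x := (l ^+ size s)^-1%:C in e1 *; set y := (l ^+ size s)%:C in e1 *.
rewrite [RHS](_ : _ = (eps%:C + (M%:C * l%:C ^+ e.*2 * x) * sqs Z ^+ e) * sqs V
  + (x * y) * (c%:C * (P * V i * V j))); last by ring.
by rewrite e1 mul1r.
Qed.

Lemma dominated0 e : dominated e (fun _ _ => 0).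
Proof.
move=> M eps eps0; exists 0 => // c Z V _.
rewrite mulr0 addr0 mpolyC0 mul0r addr0; apply: sosM; last exact: sos_sqs.
exact/sosC/ltW.
Qed.

Lemma dominatedD e w1 w2 : dominated e w1 -> dominated e w2 ->
  dominated e (fun Z V => w1 Z V + w2 Z V).
Proof.
move=> dw1 dw2 M eps eps0; have eps20 : 0 < eps / 2 by rewrite divr_gt0.
have [K1 K10 H1] := dw1 M _ eps20; have [K2 K20 H2] := dw2 M _ eps20.
exists (K1 + K2); first exact: addr_ge0.
move=> c Z V cM; have := sosD _ _ (H1 c Z V cM) (H2 c Z V cM).
congr sos; have {3}-> : eps = eps / 2 + eps / 2 by field.
by rewrite !mpolyCD; ring.
Qed.

Lemma eq_dominated e w1 w2 : (forall Z V, w1 Z V = w2 Z V) ->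
  dominated e w1 -> dominated e w2.
Proof.
move=> w12 dw M eps eps0; have [K K0 H] := dw M eps eps0.
by exists K => // c Z V cM; rewrite -w12; exact: H.
Qed.

(** The head of the list takes half of the budget [eps] and the tail the other half, so the total
    does not grow with the number of terms. *)
Lemma dominated_sum e I (r : seq I) (w : I -> ('I_n -> A) -> ('I_n -> A) -> A)
    M eps : (forall i, dominated e (w i)) -> 0 < eps ->
  exists2 K, 0 <= K & forall (c : I -> R) Z V, (forall i, `|c i| <= M) ->
  sos ((eps%:C + K%:C * sqs Z ^+ e) * sqs V + \sum_(i <- r) (c i)%:C * w i Z V).
Proof.
move=> dw; elim: r eps => [|i r IH] eps eps0.
  have [K K0 H] := dominated0 e `|M| eps eps0; exists K => // c Z V _.
  by rewrite big_nil; have := H 0 Z V; rewrite normr0 mulr0; apply.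
have eps20 : 0 < eps / 2 by rewrite divr_gt0.
have [K1 K10 H1] := dw i M _ eps20; have [K2 K20 H2] := IH _ eps20.
exists (K1 + K2); first exact: addr_ge0.
move=> c Z V cM; have := sosD _ _ (H1 _ Z V (cM i)) (H2 c Z V cM).
congr sos; rewrite big_cons; have {3}-> : eps = eps / 2 + eps / 2 by field.
by rewrite !mpolyCD; ring.
Qed.

End Domination.

(** * Directional derivatives *)

(** Induction along the ring operations instead of monomials, suited to statements about morphisms
    and derivations: only constants and variables remain to be checked. *)
Lemma mpoly_ring_ind (R : realType) (n : nat) (P : mpoly n R -> Prop) :
  (forall c, P (mpolyC n c)) -> (forall i, P (pvar i)) ->
  (forall p q, P p -> P q -> P (p + q)) ->
  (forall p q, P p -> P q -> P (p * q)) -> forall p, P p.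
Proof.
move=> PC PX PD PM; elim/mpolyind => [|c m p _ _ Pp]; first by rewrite -mpolyC0.
apply: (PD) => //; rewrite -mul_mpolyC; apply: (PM) => //.
have P1 : P 1 by rewrite -(mpolyC1 n R).
rewrite mpolyXE_id; apply: big_ind => // i _.
by elim: (m i) => [|j IH]; rewrite ?expr0// exprS; apply: PM => //; exact: PX.
Qed.

Section MonomialDerivatives.
Context {A : comNzRingType} {n : nat}.
Implicit Types (Z V : 'I_n -> A) (s : seq 'I_n).

(* First and second derivatives of z |-> \prod_(a <- s) z a at Z along V. *)
Fixpoint mono_d1 s Z V : A :=
  if s is a :: s' then V a * (\prod_(b <- s') Z b) + Z a * mono_d1 s' Z V else 0.

Fixpoint mono_d2 s Z V : A :=
  if s is a :: s' then (V a * mono_d1 s' Z V) *+ 2 + Z a * mono_d2 s' Z V else 0.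

End MonomialDerivatives.

Section DirectionalDerivatives.
Context {R : realType} {n : nat} {A : comNzRingType}.
Variables (phi : {rmorphism mpoly n R -> A}) (v : 'I_n -> A).
Implicit Types (p q : mpoly n R).

(** Values are taken in any ring reached by a morphism [phi], so that one Leibniz calculus covers
    evaluation at a point, restriction to a line, and the substitution into 2n variables, for which
    [dir2] unfolds to [hess_form]. *)
Definition dir1 p : A := \sum_i phi (mderiv i p) * v i.

Definition dir2 p : A :=
  \sum_i \sum_j phi (mderiv i (mderiv j p)) * v i * v j.

Lemma dir1D p q : dir1 (p + q) = dir1 p + dir1 q.
Proof.
by rewrite -big_split; apply: eq_bigr => i _; rewrite mderivD rmorphD mulrDl.
Qed.

Lemma dir2D p q : dir2 (p + q) = dir2 p + dir2 q.
Proof.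
rewrite -big_split; apply: eq_bigr => i _; rewrite -big_split.
by apply: eq_bigr => j _; rewrite !mderivD rmorphD !mulrDl.
Qed.

Lemma dir1C c : dir1 (mpolyC n c) = 0.
Proof. by rewrite /dir1 big1 // => i _; rewrite mderivC rmorph0 mul0r. Qed.

Lemma dir2C c : dir2 (mpolyC n c) = 0.
Proof.
rewrite /dir2 big1 // => i _; rewrite big1 // => j _.
by rewrite mderivC mderiv0 rmorph0 !mul0r.
Qed.

Lemma dir1M p q : dir1 (p * q) = dir1 p * phi q + phi p * dir1 q.
Proof.
rewrite mulr_suml mulr_sumr -big_split; apply: eq_bigr => i _ /=.
by rewrite mderivM rmorphD !rmorphM; ring.
Qed.

Lemma dir2M p q :
  dir2 (p * q) = dir2 p * phi q + (dir1 p * dir1 q) *+ 2 + phi p * dir2 q.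
Proof.
have -> : (dir1 p * dir1 q) *+ 2 =
    \sum_i \sum_j (phi (mderiv i p) * v i * (phi (mderiv j q) * v j)
                 + phi (mderiv j p) * v j * (phi (mderiv i q) * v i)).
  rewrite mulr2n; under [RHS]eq_bigr => i _ do rewrite big_split/=.
  rewrite big_split/=; congr (_ + _); rewrite [LHS]big_distrlr//=.
  exact: exchange_big.
rewrite mulr_suml mulr_sumr -!big_split; apply: eq_bigr => i _ /=.
rewrite mulr_suml mulr_sumr -!big_split; apply: eq_bigr => j _ /=.
by rewrite !(mderivM, mderivD, rmorphD, rmorphM)/=; ring.
Qed.

Lemma dir1Z c p : dir1 (c *: p) = phi (mpolyC n c) * dir1 p.
Proof. by rewrite -mul_mpolyC dir1M dir1C mul0r add0r. Qed.

Lemma dir2Z c p : dir2 (c *: p) = phi (mpolyC n c) * dir2 p.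
Proof. by rewrite -mul_mpolyC dir2M dir2C dir1C !mul0r mul0rn !add0r. Qed.

Lemma dir1_sum I (r : seq I) (F : I -> mpoly n R) :
  dir1 (\sum_(i <- r) F i) = \sum_(i <- r) dir1 (F i).
Proof.
apply: (big_morph dir1 dir1D); by rewrite -mpolyC0 dir1C.
Qed.

Lemma dir2_sum I (r : seq I) (F : I -> mpoly n R) :
  dir2 (\sum_(i <- r) F i) = \sum_(i <- r) dir2 (F i).
Proof.
apply: (big_morph dir2 dir2D); by rewrite -mpolyC0 dir2C.
Qed.

Lemma mderiv_pvar i j : mderiv i (pvar j : mpoly n R) = mpolyC n (i == j)%:R.
Proof.
rewrite /pvar mderivX mnm1E eq_sym; case: eqVneq => [->|_].
  by rewrite -{1}(add0m (mnm1 j)) addmK scale1r mpolyX0 mpolyC1.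
by rewrite scale0r mpolyC0.
Qed.

Lemma dir1_pvar i : dir1 (pvar i) = v i.
Proof.
rewrite /dir1 (bigD1 i)//= mderiv_pvar eqxx mpolyC1 rmorph1 mul1r big1 ?addr0//.
by move=> j ji; rewrite mderiv_pvar (negbTE ji) mpolyC0 rmorph0 mul0r.
Qed.

Lemma dir2_pvar i : dir2 (pvar i) = 0.
Proof.
rewrite /dir2 big1// => j _; rewrite big1// => l _.
by rewrite mderiv_pvar mderivC rmorph0 !mul0r.
Qed.

Variable x : 'rV[R]_n.
Local Notation Z := (fun i => phi (pshift x i)).

Lemma dir1_pshift i : dir1 (pshift x i) = v i.
Proof. by rewrite /pshift -mpolyCN dir1D dir1C addr0 dir1_pvar. Qed.

Lemma dir2_pshift i : dir2 (pshift x i) = 0.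
Proof. by rewrite /pshift -mpolyCN dir2D dir2C addr0 dir2_pvar. Qed.

Lemma dir1_mono s : dir1 (\prod_(i <- s) pshift x i) = mono_d1 s Z v.
Proof.
elim: s => [|a s IH]; first by rewrite big_nil -mpolyC1 dir1C.
by rewrite big_cons dir1M IH dir1_pshift rmorph_prod.
Qed.

Lemma dir2_mono s : dir2 (\prod_(i <- s) pshift x i) = mono_d2 s Z v.
Proof.
elim: s => [|a s IH]; first by rewrite big_nil -mpolyC1 dir2C.
by rewrite big_cons dir2M IH dir1_mono dir1_pshift dir2_pshift mul0r add0r.
Qed.

Let S := \sum_i pshift x i ^+ 2.
Let phiS := \sum_i Z i ^+ 2.
Let Zv := \sum_i Z i * v i.

Let phi_S : phi S = phiS.
Proof. by rewrite /S rmorph_sum; apply: eq_bigr => i _; rewrite rmorphXn. Qed.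

Let dir1_S : dir1 S = Zv *+ 2.
Proof.
rewrite dir1_sum /Zv -sumrMnl; apply: eq_bigr => i _.
by rewrite expr2 dir1M dir1_pshift; ring.
Qed.

Let dir2_S : dir2 S = (\sum_i v i ^+ 2) *+ 2.
Proof.
rewrite dir2_sum -sumrMnl; apply: eq_bigr => i _.
by rewrite expr2 dir2M dir2_pshift dir1_pshift; ring.
Qed.

Lemma dir1_reg e : dir1 (S ^+ e.+1) = (phiS ^+ e * Zv) *+ e.+1.*2.
Proof.
elim: e => [|e IH]; first by rewrite expr1 dir1_S expr0 mul1r.
rewrite exprS dir1M IH dir1_S rmorphXn phi_S.
by rewrite -!muln2 !exprS; ring.
Qed.

Lemma dir2_reg e : dir2 (S ^+ e.+2) =
  (phiS ^+ e.+1 * \sum_i v i ^+ 2) *+ e.+2.*2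
  + (phiS ^+ e * Zv ^+ 2) *+ (4 * (e.+2 * e.+1)).
Proof.
(* Stated from j = 0 for the induction; there the exponent [j.-1] is a dummy, as the multiplicity 4
   * (j.+1 * j) vanishes. *)
have dir2_SX j : dir2 (S ^+ j.+1) = (phiS ^+ j * \sum_i v i ^+ 2) *+ j.+1.*2
    + (phiS ^+ j.-1 * Zv ^+ 2) *+ (4 * (j.+1 * j)).
  elim: j => [|j IH].
    by rewrite expr1 dir2_S expr0 mul1r !muln0 mulr0n addr0.
  rewrite exprS dir2M IH dir1_reg dir2_S dir1_S rmorphXn phi_S.
  case: j {IH} => [|j] /=; first by rewrite -!muln2; ring.
  by rewrite -!muln2 !exprS; ring.
exact: dir2_SX.
Qed.

End DirectionalDerivatives.

(** * Restriction to lines *)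

Lemma poly_second_order (R : rcfType) (p : {poly R}) (c : R) :
  (forall t, 0 <= t <= 1 -> c <= p^`()^`().[t]) ->
  p.[0] + p^`().[0] + c / 2 <= p.[1].
Proof.
(* The claim becomes w(0) <= w(1). The mean value theorem gives w(1) - w(0) = w'(t), and a second
   use of it, for p', gives w'(t) = (p''(u) - c) t >= 0. *)
move=> pc; pose w := p - p^`().[0] *: 'X - (c / 2) *: ('X * 'X).
have [t] := polyrcf.poly_mvt w (@ltr01 R).
rewrite in_itv/= => /andP[t0 t1].
have [u] := polyrcf.poly_mvt (p^`()) t0.
rewrite in_itv/= => /andP[u0 ut].
have cu : c <= p^`()^`().[u].
  by apply: pc; rewrite ltW//= ltW// (lt_trans ut).
rewrite /w !poly.derivE !hornerE => pt wt.
have : c * t <= p^`()^`().[u] * t by rewrite ler_wpM2r// ltW.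
move: pt wt; rewrite !subr0 mulr1 /= => pt wt ?. lra.
Qed.

Section Lines.
Context {R : realType} {n : nat}.
Implicit Types (p q : mpoly n R) (x y v : 'rV[R]_n).

Local Notation ev x := (meval (fun i => x 0 i)).

(** Kept as a univariate polynomial, the restriction is subject to the algebraic mean value theorem;
    as a ring morphism, it is an instance of [phi] in [dir1] and [dir2]. *)
Definition line x v : mpoly n R -> {poly R} :=
  mmap polyC (fun i => (x 0 i)%:P + v 0 i *: 'X).

HB.instance Definition _ x v := GRing.RMorphism.on (line x v).

Lemma horner_line x v p t : (line x v p).[t] = peval p (x + t *: v).
Proof.
rewrite /peval; elim/mpoly_ring_ind: p => [c|i|p q IHp IHq|p q IHp IHq].
- by rewrite /line mmapC mevalC hornerC.
- by rewrite /line /pvar mmapX mmap1U mevalXU !mxE !hornerE mulrC.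
- by rewrite rmorphD hornerD IHp IHq rmorphD.
- by rewrite rmorphM hornerM IHp IHq rmorphM.
Qed.

Lemma deriv_line x v p :
  (line x v p)^`() = dir1 (line x v) (fun i => (v 0 i)%:P) p.
Proof.
elim/mpoly_ring_ind: p => [c|i|p q IHp IHq|p q IHp IHq].
- by rewrite dir1C /line mmapC derivC.
- by rewrite dir1_pvar /line /pvar mmapX mmap1U !poly.derivE add0r alg_polyC.
- by rewrite rmorphD derivD IHp IHq dir1D.
- by rewrite rmorphM derivM IHp IHq dir1M.
Qed.

Lemma deriv2_line x v p :
  (line x v p)^`()^`() = dir2 (line x v) (fun i => (v 0 i)%:P) p.
Proof.
rewrite deriv_line /dir1 raddf_sum /dir2 exchange_big; apply: eq_bigr => i _ /=.
by rewrite derivM derivC mulr0 addr0 deriv_line mulr_suml.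
Qed.

Lemma horner_deriv_line x v p t :
  (line x v p)^`().[t] = dir1 (ev (x + t *: v)) (fun i => v 0 i) p.
Proof.
rewrite deriv_line horner_sum; apply: eq_bigr => i _.
by rewrite hornerM hornerC horner_line.
Qed.

Lemma horner_deriv2_line x v p t :
  (line x v p)^`()^`().[t] = dir2 (ev (x + t *: v)) (fun i => v 0 i) p.
Proof.
rewrite deriv2_line horner_sum; apply: eq_bigr => i _.
rewrite horner_sum; apply: eq_bigr => j _.
by rewrite !hornerM !hornerC horner_line.
Qed.

Lemma peval_second_order p x v c :
  (forall t, 0 <= t <= 1 -> c <= dir2 (ev (x + t *: v)) (fun i => v 0 i) p) ->
  peval p x + dir1 (ev x) (fun i => v 0 i) p + c / 2 <= peval p (x + v).
Proof.
move=> pc; have := @poly_second_order _ (line x v p) c.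
rewrite !horner_line horner_deriv_line scale0r scale1r addr0; apply => t t01.
by rewrite horner_deriv2_line; exact: pc.
Qed.

Lemma peval_mvt p x v t : 0 < t -> exists2 u, 0 < u < t &
  peval p (x + t *: v) = peval p x + t * dir1 (ev (x + u *: v)) (fun i => v 0 i) p.
Proof.
move=> t0; have [u] := polyrcf.poly_mvt (line x v p) t0.
rewrite in_itv/= => ut; rewrite !horner_line horner_deriv_line scale0r addr0 subr0.
by move=> H; exists u => //; rewrite mulrC -H addrCA subrr addr0.
Qed.

Lemma peval_continuous p : continuous (peval p).
Proof.
elim/mpoly_ring_ind: p => [c|i|p q IHp IHq|p q IHp IHq] x.
- rewrite (_ : peval _ = cst c); first exact: cst_continuous.
  by apply/funext => y; rewrite /peval mevalC.
- rewrite (_ : peval _ = fun y => y 0 i); first exact: coord_continuous.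
  by apply/funext => y; rewrite /peval /pvar mevalXU.
- rewrite (_ : peval _ = peval p \+ peval q).
    by apply: continuousD; [exact: IHp | exact: IHq].
  by apply/funext => y; rewrite /peval rmorphD.
- rewrite (_ : peval _ = peval p \* peval q).
    by apply: continuousM; [exact: IHp | exact: IHq].
  by apply/funext => y; rewrite /peval rmorphM.
Qed.

Lemma dir1_continuous p (v : 'I_n -> R) : continuous (fun x => dir1 (ev x) v p).
Proof.
apply: continuous_big => [|i _ x]; first exact: add_continuous.
apply: (@continuousM _ _ (peval (mderiv i p)) (cst (v i))); first exact: peval_continuous.
exact: cst_continuous.
Qed.

Lemma dir1Zv p x t (v : 'I_n -> R) :
  dir1 (ev x) (fun i => t * v i) p = t * dir1 (ev x) v p.
Proof. by rewrite mulr_sumr; apply: eq_bigr => i _; rewrite mulrCA. Qed.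

Lemma hess_form_dir2 p x v :
  peval (hess_form p) (row_mx x v) = dir2 (ev x) (fun i => v 0 i) p.
Proof.
rewrite hess_formE mxE /dir2 exchange_big; apply: eq_bigr => j _ /=.
rewrite !mxE mulr_suml; apply: eq_bigr => i _ /=.
by rewrite !mxE /peval; ring.
Qed.

Lemma sosconvex_dir2 p x (v : 'rV[R]_n) : sosconvex p ->
  0 <= dir2 (ev x) (fun i => v 0 i) p.
Proof.
move=> [s ps]; rewrite -hess_form_dir2 ps /peval rmorph_sum; apply: sumr_ge0 => q _.
by rewrite rmorphXn sqr_ge0.
Qed.

Lemma sosconvex_grad p x y : sosconvex p ->
  peval p x + dir1 (ev x) (fun i => (y - x) 0 i) p <= peval p y.
Proof.
move=> cp; have := peval_second_order p x (y - x) 0.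
rewrite mul0r addr0 [x + _]addrC subrK; apply => t _.
exact: sosconvex_dir2.
Qed.

(** The tangent inequality is taken at the intermediate point w towards both ends; with weights 1 -
    t and t the two gradient terms cancel. *)
Lemma sosconvex_convex p x y t : sosconvex p -> 0 <= t <= 1 ->
  peval p (x + t *: (y - x)) <= (1 - t) * peval p x + t * peval p y.
Proof.
move=> cp /andP[t0 t1]; set w := x + _.
have := sosconvex_grad p w x cp; have := sosconvex_grad p w y cp.
have -> : (fun i => (y - w) 0 i) = (fun i => (1 - t) * (y - x) 0 i).
  by apply/funext => i; rewrite /w !mxE; ring.
have -> : (fun i => (x - w) 0 i) = (fun i => (- t) * (y - x) 0 i).
  by apply/funext => i; rewrite /w !mxE; ring.
rewrite !dir1Zv; set g := dir1 _ _ _ => Hy Hx.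
have := ler_wpM2l t0 Hy; have t1' : 0 <= 1 - t by rewrite subr_ge0.
have := ler_wpM2l t1' Hx; set W := peval p w; set X := peval p x.
set Y := peval p y => ? ?; lra.
Qed.

End Lines.

(** * Minimization over a closed cone *)

Section ConeMinimum.
Context {R : realType} {N : nat} {J : finType}.
Implicit Types (w : 'rV[R]_N).

Lemma closed_preimage (T U : topologicalType) (f : T -> U) (B : set U) :
  continuous f -> closed B -> closed (f @^-1` B).
Proof. by move=> /continuous_closedP cf; exact: cf. Qed.

Lemma closed_zeros (T : topologicalType) (h : J -> T -> R) :
  (forall j, continuous (h j)) -> closed [set x | forall j, h j x = 0].
Proof.
move=> ch; rewrite (_ : mkset _ = \bigcap_(j in setT) (h j @^-1` [set 0])).
  apply: closed_bigI => j _.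
  exact: (closed_preimage _ _ _ _ (ch j) (@closed_eq _ (0 : R))).
by apply/seteqP; split => [x H j _|x H j]; [exact: H|exact: H].
Qed.

(* The program min t subject to h w = p + t q, w in K has compact sublevel sets
   because, K being a closed cone on which h only vanishes at 0, |w| = O(|h w|) on K. *)
Lemma cone_min (K : set 'rV[R]_N) (h : J -> 'rV[R]_N -> R) (p q : J -> R) :
  closed K -> (forall c w, 0 <= c -> K w -> K (c *: w)) ->
  (forall j, continuous (h j)) -> (forall j c w, h j (c *: w) = c * h j w) ->
  (forall w, K w -> (forall j, h j w = 0) -> w = 0) ->
  let S := [set t | 0 <= t /\ exists2 w, K w & forall j, h j w = p j + t * q j] in
  S !=set0 -> exists2 t, S t & lbound S t.
Proof.
move=> clK coneK ch hZ injK S [t0 [t00 [w0 Kw0 w0E]]].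
pose phi w := \sum_j `|h j w|.
have cphi : continuous phi.
  apply: continuous_big => [|j _ w]; first exact: add_continuous.
  by apply: (@continuous_comp _ _ _ (h j) Num.norm); [exact: ch|exact: norm_continuous].
have phi0 w : phi w = 0 -> forall j, h j w = 0.
  move=> /eqP; rewrite psumr_eq0// => /allP H j.
  by have /= := H j (mem_index_enum j); rewrite normr_eq0 => /eqP.
have phiZ c w : phi (c *: w) = `|c| * phi w.
  by rewrite /phi mulr_sumr; apply: eq_bigr => j _; rewrite hZ normrM.
(* [dl] is the minimum of [phi] on the unit vectors of K, positive because h does not vanish there.
   If K has no unit vector, it contains at most 0 and any constant will do. *)
have [dl dl0 Hdl] : exists2 dl, 0 < dl & forall w, K w -> dl * `|w| <= phi w.
  pose Sp := K `&` [set w | `|w| = 1].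
  have clSp : closed Sp.
    apply: closedI => //.
    apply: (closed_preimage _ _ (fun w => `|w|) [set 1]); last exact: closed_eq.
    exact: norm_continuous.
  have bSp : bounded_set Sp.
    exists 1; split => [|x x1 w [_ /= ->]]; [exact: real1 | exact: ltW].
  have coSp := bounded_closed_compact bSp clSp.
  have phi_ge0 w : 0 <= phi w by exact: sumr_ge0.
  have inSp w : K w -> w != 0 -> Sp (`|w|^-1 *: w).
    move=> Kw w0N; split; first by apply: coneK => //; rewrite invr_ge0.
    by rewrite /= normrZ normfV normr_id mulVf// normr_eq0.
  have [[u Spu]|Sp0] := pselect (Sp !=set0); last first.
    exists 1 => // w Kw; have [->|w0N] := eqVneq w 0.
      by rewrite normr0 mulr0.
    by exfalso; apply: Sp0; exists (`|w|^-1 *: w); exact: inSp.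
  have [|c cSp Hc] := compact_EVT_min (ex_intro _ u Spu) coSp (f := phi).
    by apply: continuous_subspaceT.
  have [Kc c1] : Sp c by rewrite inE in cSp.
  exists (phi c).
    rewrite lt_neqAle phi_ge0 andbT eq_sym; apply/eqP => /phi0 /(injK _ Kc) c0.
    by move: c1; rewrite /= c0 normr0 => /eqP; rewrite eq_sym oner_eq0.
  move=> w Kw; have [->|w0N] := eqVneq w 0; first by rewrite normr0 mulr0.
  have := Hc (`|w|^-1 *: w); rewrite inE => /(_ (inSp _ Kw w0N)).
  by rewrite phiZ normfV normr_id mulrC ler_pdivlMr ?normr_gt0.
(* For t in [0, t0] the constraints give dl |w| <= phi w <= dl B, which confines w; a t above t0
   cannot beat t0. *)
pose B := (\sum_j (`|p j| + t0 * `|q j|)) / dl.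
pose Kb := K `&` [set w | `|w| <= B].
have coKb : compact Kb.
  apply: bounded_closed_compact.
    exists B; split => [|x Bx w [_ wB]]; first exact: num_real.
    exact: le_trans wB (ltW Bx).
  apply: closedI => //.
  apply: (closed_preimage _ _ (fun w => `|w|) [set x | x <= B]); last exact: closed_le.
  exact: norm_continuous.
pose E := [set x : R * 'rV[R]_N |
  forall j, h j x.2 - (p j + x.1 * q j) = 0].
have clE : closed E.
  apply: (closed_zeros _
    (fun j (x : R * 'rV[R]_N) => h j x.2 - (p j + x.1 * q j))) => j x.
  apply: (@continuousB _ _ _ (fun x : R * 'rV[R]_N => h j x.2)
      (fun x => p j + x.1 * q j)).
    apply: (@continuous_comp _ _ _ snd (h j)); first exact: cvg_snd.
    exact: ch.
  apply: (@continuousD _ _ _ (cst (p j)) (fun x : R * 'rV[R]_N => x.1 * q j)).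
    exact: cst_continuous.
  apply: (@continuousM _ _ (fun x : R * 'rV[R]_N => x.1) (cst (q j))).
    exact: cvg_fst.
  exact: cst_continuous.
pose X := (`[0, t0]%classic `*` Kb) `&` E.
have coX : compact X.
  apply: compact_closedI => //; apply: compact_setX => //.
  exact: segment_compact.
have inX t w : 0 <= t <= t0 -> K w -> (forall j, h j w = p j + t * q j) -> X (t, w).
  move=> /andP[t0' tt0] Kw wE; split; [split|] => /=.
  - by rewrite in_itv/= t0'.
  - split => //=; rewrite /B ler_pdivlMr// mulrC; apply: le_trans (Hdl _ Kw) _.
    apply: ler_sum => j _; rewrite wE; apply: le_trans (ler_normD _ _) _.
    by rewrite lerD2l normrM ger0_norm// ler_wpM2r.
  - by move=> j; rewrite wE subrr.
have X0 : X !=set0 by exists (t0, w0); apply: inX => //; rewrite t00 lexx.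
have [|[ts ws]] := compact_EVT_min X0 coX (f := fst).
  by apply: continuous_subspaceT => x; exact: cvg_fst.
rewrite inE => -[[/= tsI [Kws _]] Ews] Hts; exists ts.
  split; first by move: tsI; rewrite in_itv/= => /andP[].
  by exists ws => // j; apply/eqP; rewrite -subr_eq0; apply/eqP/(Ews j).
move=> t [t_ge0 [w Kw wE]].
have [tt0|tt0] := leP t t0.
  have := Hts (t, w); rewrite inE; apply; apply: inX => //.
  by rewrite t_ge0.
apply: le_trans (ltW tt0).
by move: tsI; rewrite in_itv/= => /andP[].
Qed.

End ConeMinimum.

(** * Gram matrices *)

Section PsdDecomposition.
Context {R : realType} {n : nat}.
Implicit Types (A : 'M[R]_n) (v : 'rV[R]_n).

Definition qform A v : R := (v *m A *m v^T) 0 0.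

Lemma tr00 (B : 'M[R]_1) : B 0 0 = B^T 0 0.
Proof. by rewrite mxE. Qed.

Lemma qform_shift A v t i : A^T = A ->
  qform A (v + t *: delta_mx 0 i) =
  qform A v + t * (v *m A) 0 i *+ 2 + t ^+ 2 * A i i.
Proof.
move=> symA; set e := delta_mx 0 i : 'rV[R]_n.
have mulde (u : 'rV[R]_n) : (u *m e^T) 0 0 = u 0 i by rewrite trmx_delta -colE mxE.
have eAv : (e *m A *m v^T) 0 0 = (v *m A) 0 i.
  by rewrite (tr00 (_ *m _)) !trmx_mul trmxK symA mulmxA mulde.
have eAe : (e *m A *m e^T) 0 0 = A i i by rewrite mulde -rowE mxE.
have addE (B C : 'M[R]_1) : (B + C) 0 0 = B 0 0 + C 0 0 by rewrite mxE.
have scE c (B : 'M[R]_1) : (c *: B) 0 0 = c * B 0 0 by rewrite mxE.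
rewrite /qform linearD/= linearZ/= !(mulmxDl, mulmxDr) -!scalemxAl -!scalemxAr.
by rewrite !(addE, scE) mulde eAv eAe; ring.
Qed.

Lemma qform_delta A i : qform A (delta_mx 0 i) = A i i.
Proof. by rewrite /qform trmx_delta -rowE -colE !mxE. Qed.

Lemma qform_outer (u v : 'rV[R]_n) : qform (u^T *m u) v = (v *m u^T) 0 0 ^+ 2.
Proof.
rewrite /qform mulmxA -mulmxA mxE big_ord1 expr2; congr (_ * _).
by rewrite tr00 trmx_mul trmxK.
Qed.

Lemma qformE A v : qform A v = \sum_i \sum_j A i j * v 0 i * v 0 j.
Proof.
rewrite /qform mxE exchange_big; apply: eq_bigr => j _ /=.
by rewrite !mxE mulr_suml; apply: eq_bigr => i _; rewrite [v 0 i * _]mulrC.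
Qed.

(** Symmetric Gaussian elimination, by induction on the number of nonzero diagonal entries.
    Subtracting the rank-one matrix built from row i clears the entry (i, i); zero diagonal entries
    stay zero, since the diagonal only decreases and the remainder is still psd. *)
Lemma psd_decomposition A : A^T = A -> psdmx A ->
  exists s : seq 'rV[R]_n, A = \sum_(u <- s) u^T *m u.
Proof.
have [c Ac] := ubnP #|[pred i | A i i != 0]|.
elim: c A Ac => // c IH A Ac symA psdA.
have diag_ge0 i : 0 <= A i i by rewrite -qform_delta; exact: psdA.
have [i /= Ai|A0] := pickP [pred i | A i i != 0]; last first.
  exists [::]; rewrite big_nil; apply/matrixP => i j; rewrite [RHS]mxE.
  (* With zero diagonal, the form at e_i - A_ij e_j is - 2 A_ij^2, which forces A_ij = 0. *)
  have := psdA (delta_mx 0 i + (- A i j) *: delta_mx 0 j).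
  rewrite -/(qform _ _) qform_shift// qform_delta -rowE mxE.
  have /= /negbFE /eqP -> := A0 i; have /= /negbFE /eqP -> := A0 j.
  by move=> H; apply/eqP; rewrite -sqrf_eq0 eq_le sqr_ge0 andbT expr2; lra.
pose a := A i i; have a0 : 0 < a by rewrite lt_neqAle eq_sym Ai diag_ge0.
pose u := Num.sqrt a^-1 *: row i A.
have uE j k : (u^T *m u) j k = a^-1 * (A i j * A i k).
  rewrite mxE big_ord1 !mxE mulrACA -expr2 sqr_sqrtr ?invr_ge0 ?ltW//.
pose A' := A - u^T *m u.
have A'E j : A' j j = A j j - a^-1 * A i j ^+ 2 by rewrite /A' !mxE -uE mxE.
have symA' : A'^T = A' by rewrite linearB/= trmx_mul trmxK symA.
have psdA' : psdmx A'.
  move=> v; rewrite -/(qform _ _).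
  have -> : qform A' v = qform A v - a^-1 * (v *m A) 0 i ^+ 2.
    have subE (B C : 'M[R]_1) : (B - C) 0 0 = B 0 0 - C 0 0 by rewrite !mxE.
    rewrite {1}/qform mulmxBr mulmxBl subE.
    rewrite -[X in _ - X]/(qform _ _) qform_outer.
    have -> : (v *m u^T) 0 0 = Num.sqrt a^-1 * (v *m A) 0 i.
      rewrite !mxE mulr_sumr; apply: eq_bigr => k _.
      by rewrite !mxE -{1}symA mxE mulrCA.
    by rewrite exprMn sqr_sqrtr// invr_ge0 ltW.
  (* Minimizing the form of A along the line v + t e_i yields exactly the value of A' at v. *)
  have := psdA (v + (- (a^-1 * (v *m A) 0 i)) *: delta_mx 0 i).
  rewrite -/(qform _ _) qform_shift// -/a; set b := (v *m A) 0 i.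
  rewrite (_ : _ + _ = qform A v - a^-1 * b ^+ 2)//.
  by field; rewrite gt_eqF.
have [|s sE] := IH A' _ symA' psdA'; last first.
  by exists (u :: s); rewrite big_cons -sE /A' addrC subrK.
have diag_ge0' j : 0 <= A' j j by rewrite -qform_delta; exact: psdA'.
rewrite -ltnS (leq_trans _ Ac)// ltnS; apply: proper_card; apply/properP; split.
  apply/fintype.subsetP => j; rewrite !inE; apply: contra => /eqP Aj.
  rewrite eq_le diag_ge0' andbT A'E Aj sub0r oppr_le0.
  by rewrite mulr_ge0 ?sqr_ge0// invr_ge0 ltW.
exists i; rewrite !inE// negbK A'E -/a expr2 mulrA mulVf ?mul1r ?subrr//.
Qed.

(** [psdmx] says nothing about symmetry, so the decomposition is applied to the symmetric part,
    which defines the same form. *)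
Lemma sos_qform k A (V : 'I_n -> mpoly k R) : psdmx A ->
  sos (\sum_i \sum_j mpolyC k (A i j) * V i * V j).
Proof.
move=> psdA; pose B := 2^-1 *: (A + A^T).
have symB : B^T = B by rewrite linearZ/= linearD/= trmxK addrC.
have psdB : psdmx B.
  move=> v; rewrite -/(qform _ _) qformE.
  have := psdA v; rewrite -/(qform _ _) qformE => A0.
  rewrite (_ : \sum_i _ = \sum_i \sum_j A i j * v 0 i * v 0 j)//.
  transitivity (2^-1 * (\sum_i \sum_j A i j * v 0 i * v 0 j)
              + 2^-1 * (\sum_i \sum_j A j i * v 0 j * v 0 i)).
    rewrite !mulr_sumr -big_split; apply: eq_bigr => i _ /=.
    rewrite !mulr_sumr -big_split; apply: eq_bigr => j _ /=.
    by rewrite !mxE; ring.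
  by rewrite [X in _ + _ * X]exchange_big/=; lra.
have [s sE] := psd_decomposition _ symB psdB.
rewrite (_ : \sum_i _ = \sum_(u <- s) (\sum_i mpolyC k (u 0 i) * V i) ^+ 2).
  by apply: sos_sum => u _; exact: sos_sqr.
have half : mpolyC k (2^-1 : R) + mpolyC k 2^-1 = 1.
  by rewrite -mpolyCD -mpolyC1; congr mpolyC; lra.
transitivity (\sum_i \sum_j mpolyC k (B i j) * V i * V j).
  transitivity (mpolyC k 2^-1 * (\sum_i \sum_j mpolyC k (A i j) * V i * V j)
              + mpolyC k 2^-1 * (\sum_i \sum_j mpolyC k (A j i) * V j * V i)).
    by rewrite [X in _ + _ * X]exchange_big/= -mulrDl half mul1r.
  rewrite !mulr_sumr -big_split; apply: eq_bigr => i _ /=.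
  rewrite !mulr_sumr -big_split; apply: eq_bigr => j _ /=.
  by rewrite !mxE mpolyCM mpolyCD; ring.
transitivity (\sum_i \sum_j \sum_(u <- s) mpolyC k (u 0 i) * V i * (mpolyC k (u 0 j) * V j)).
  apply: eq_bigr => i _; apply: eq_bigr => j _.
  rewrite sE summxE raddf_sum/= !mulr_suml; apply: eq_bigr => u _.
  by rewrite mxE big_ord1 mxE mpolyCM; ring.
under eq_bigr do rewrite exchange_big/=.
rewrite exchange_big/=; apply: eq_bigr => u _.
by rewrite expr2 big_distrlr.
Qed.

End PsdDecomposition.

(** * Degrees of the terms of a sum of squares *)

Section SosDegree.
Context {R : realType} {k : nat}.
Implicit Types (p q : mpoly k R).

(** Squares cannot cancel at the top: if m is the largest leading monomial among the terms, the
    coefficient of m + m in the sum is a sum of squares, not all zero, and the monomial order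
    refines the degree. As [msize] is the degree plus one, twice D on the sum gives D on each
    term. *)
Lemma sos_msize (s : seq (mpoly k R)) q D :
  (msize (\sum_(q <- s) q ^+ 2) <= D.*2)%N -> q \in s -> (msize q <= D)%N.
Proof.
set p := \sum_(q <- s) _ => pD qs; rewrite leqNgt; apply/negP => Dq.
have q0 : q != 0 by apply: contraTneq Dq => ->; rewrite msize0.
pose s' := [seq q <- s | q != 0].
have qs' : q \in s' by rewrite mem_filter q0.
have [y ys' ymax] : exists2 y, y \in s' & forall z, z \in s' -> (mlead z <= mlead y)%O.
  elim: s' (q) qs' {Dq q0 qs} => // a [|b r] IH x _.
    by exists a => [|z]; rewrite ?mem_head// inE => /eqP->.
  have [|y ry Hy] := IH b; first exact: mem_head.
  have [ay|ya] := leP (mlead a) (mlead y).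
    by exists y => [|z]; rewrite inE ?ry ?orbT// => /predU1P[->//|]; exact: Hy.
  exists a => [|z]; rewrite ?mem_head// inE => /predU1P[->//|/Hy zy].
  exact: le_trans zy (ltW ya).
have y0 : y != 0 by move: ys'; rewrite mem_filter => /andP[].
set m := mlead y in ymax.
have pm : mcoeff (mnm_add m m) p = \sum_(z <- s) mcoeff m z ^+ 2.
  rewrite raddf_sum/=; apply: eq_big_seq => z zs.
  have [->|z0] := eqVneq z 0; first by rewrite expr2 mul0r !mcoeff0 expr2 mul0r.
  have zm : (mlead z <= m)%O by apply: ymax; rewrite mem_filter z0.
  by rewrite !expr2 mleadcMW.
have : mcoeff (mnm_add m m) p != 0.
  rewrite pm psumr_eq0; last by move=> z _; exact: sqr_ge0.
  apply/allPn; exists y; first by move: ys'; rewrite mem_filter => /andP[].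
  by rewrite /= sqrf_eq0 mleadc_eq0.
rewrite -mcoeff_msupp => /msize_mdeg_lt; rewrite mdegD => mp.
have mq : (mdeg (mlead q) <= mdeg m)%N by apply: lemc_mdeg; exact: ymax.
have := mlead_deg q0; lia.
Qed.

End SosDegree.

(** * SOS programs in one parameter *)

Section SosMinimum.
Context {R : realType} {k : nat}.
Implicit Types (p q : mpoly k R).

Section Gram.
Variable D : nat.
Local Notation N := #|{: bmultinom k D}|.
Implicit Types (G : 'M[R]_N) (u : 'rV[R]_N).

Let mon (a : 'I_N) : mpoly k R := mpolyX R (bmnm (enum_val a)).

(** The form of G at the vector of all monomials of degree below D; its values at psd matrices are
    the SOS polynomials of degree below 2D. *)
Definition gram G : mpoly k R := \sum_a \sum_b mpolyC k (G a b) * mon a * mon b.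

Definition lincomb u : mpoly k R := \sum_a u 0 a *: mon a.

Lemma gram_sum_outer (s : seq 'rV[R]_N) :
  gram (\sum_(u <- s) u^T *m u) = \sum_(u <- s) lincomb u ^+ 2.
Proof.
transitivity (\sum_a \sum_b \sum_(u <- s) u 0 a *: mon a * (u 0 b *: mon b)).
  apply: eq_bigr => a _; apply: eq_bigr => b _.
  rewrite summxE raddf_sum/= !mulr_suml; apply: eq_bigr => u _.
  by rewrite mxE big_ord1 mxE mpolyCM -!mul_mpolyC; ring.
under eq_bigr do rewrite exchange_big/=.
rewrite exchange_big/=; apply: eq_bigr => u _.
by rewrite expr2 big_distrlr.
Qed.

Lemma mcoeff_lincomb u a : mcoeff (bmnm (enum_val a)) (lincomb u) = u 0 a.
Proof.
rewrite raddf_sum (bigD1 a)//= mcoeffZ mcoeffX eqxx mulr1 big1 ?addr0// => b ba.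
rewrite mcoeffZ mcoeffX; case: eqP => [/val_inj /enum_val_inj e|]; last by rewrite mulr0.
by rewrite e eqxx in ba.
Qed.

Lemma sos_gram p : (msize p <= D.*2)%N -> sos p ->
  exists2 G, G^T = G /\ psdmx G & p = gram G.
Proof.
move=> pD [s ps]; pose vec q : 'rV[R]_N := \row_a mcoeff (bmnm (enum_val a)) q.
have vecK q : q \in s -> lincomb (vec q) = q.
  move=> qs; have qD : (msize q <= D)%N by apply: sos_msize qs; rewrite -ps.
  rewrite [RHS](mpolywE qD) (reindex_onto enum_val enum_rank)/=; last first.
    by move=> m _; rewrite enum_rankK.
  apply: eq_big => [a|a _]; first by rewrite enum_valK eqxx.
  by rewrite mxE.
pose G := \sum_(u <- [seq vec q | q <- s]) u^T *m u.
exists G; last first.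
  by rewrite gram_sum_outer big_map ps; apply: eq_big_seq => q /vecK ->.
split; first by rewrite raddf_sum; apply: eq_bigr => u _; rewrite /= trmx_mul trmxK.
move=> v; rewrite /G mulmx_sumr mulmx_suml summxE; apply: sumr_ge0 => u _.
by rewrite -/(qform _ _) qform_outer sqr_ge0.
Qed.

(** A polynomial may have many Gram matrices, but on the psd cone [gram] only vanishes at 0: the
    terms of a zero sum of squares are zero, by [sos_msize] at D = 0. This is the injectivity
    required by [cone_min]. *)
Lemma gram_eq0 G : G^T = G -> psdmx G -> gram G = 0 -> G = 0.
Proof.
move=> symG psdG; have [s ->] := psd_decomposition _ symG psdG.
rewrite gram_sum_outer => s0; rewrite big_seq big1// => u us.
suff -> : u = 0 by rewrite mulmx0.
have lu0 : lincomb u = 0.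
  apply/eqP; rewrite -msize_poly_eq0 -leqn0.
  apply: (sos_msize [seq lincomb u | u <- s]); last exact: map_f.
  by rewrite big_map s0 msize0.
by apply/rowP => a; rewrite mxE -mcoeff_lincomb lu0 mcoeff0.
Qed.

Lemma sos_gram_psd G : psdmx G -> sos (gram G).
Proof. exact: sos_qform. Qed.

Lemma mcoeff_gram m G : mcoeff m (gram G) =
  \sum_a \sum_b G a b * mcoeff m (mon a * mon b).
Proof.
rewrite raddf_sum; apply: eq_bigr => a _; rewrite raddf_sum; apply: eq_bigr => b _ /=.
by rewrite -mulrA mcoeffCM.
Qed.

Lemma mcoeff_gram_large m G : (D.*2 <= mdeg m)%N -> mcoeff m (gram G) = 0.
Proof.
move=> Dm; rewrite mcoeff_gram big1// => a _; rewrite big1// => b _.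
rewrite -mpolyXD mcoeffX; case: eqP => [ab|]; last by rewrite mulr0.
have := bmdeg (enum_val a); have := bmdeg (enum_val b).
by move: Dm; rewrite -ab mdegD; lia.
Qed.

End Gram.

Lemma vec_mx_continuous n (i j : 'I_n) :
  continuous (fun w : 'rV[R]_(n * n) => vec_mx w i j).
Proof.
rewrite (_ : (fun w => _) = fun w : 'rV_(n * n) => w 0 (mxvec_index i j)).
  exact: coord_continuous.
by apply/funext => w; rewrite mxE.
Qed.

Lemma qform_continuous n (v : 'rV[R]_n) :
  continuous (fun w : 'rV[R]_(n * n) => qform (vec_mx w) v).
Proof.
rewrite (_ : (fun w => _) =
  fun w : 'rV_(n * n) => \sum_i \sum_j w 0 (mxvec_index i j) * (v 0 i * v 0 j)).
  apply: continuous_big => [|i _]; first exact: add_continuous.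
  apply: continuous_big => [|j _ w]; first exact: add_continuous.
  apply: (@continuousM _ _ (fun w : 'rV_(n * n) => w 0 (mxvec_index i j)) (cst _)).
    exact: coord_continuous.
  exact: cst_continuous.
apply/funext => w; rewrite qformE; apply: eq_bigr => i _; apply: eq_bigr => j _.
by rewrite mxE mulrA.
Qed.

Lemma sos_min p q : let S := [set t : R | 0 <= t /\ sos (p + t *: q)] in
  S !=set0 -> exists2 t, S t & lbound S t.
Proof.
move=> S S0; pose D := maxn (msize p) (msize q).
pose N := #|{: bmultinom k D}|.
pose K := [set w : 'rV[R]_(N * N) | (vec_mx w)^T = vec_mx w /\ psdmx (vec_mx w)].
(* Finitely many equations suffice: from degree 2D on, the coefficients of both sides are zero. *)
pose h (m : bmultinom k D.*2) (w : 'rV[R]_(N * N)) := mcoeff m (gram D (vec_mx w)).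
have ptD t : (msize (p + t *: q) <= D.*2)%N.
  apply: leq_trans (msizeD_le _ _) _; rewrite geq_max /D; apply/andP; split; first lia.
  by apply: leq_trans (msizeZ_le _ _) _; lia.
have SE : S = [set t | 0 <= t /\ exists2 w, K w & forall m, h m w = mcoeff m p + t * mcoeff m q].
  apply/seteqP; split => t /= [t0 H]; split => //.
    have [G [symG psdG] GE] := sos_gram D _ (ptD t) H.
    exists (mxvec G); first by rewrite /K/= mxvecK.
    by move=> m; rewrite /h mxvecK -GE mcoeffD mcoeffZ.
  have [w [symw psdw] hw] := H.
  rewrite (_ : _ + _ = gram D (vec_mx w)); first exact: sos_gram_psd.
  apply/mpolyP => m; have [mD|Dm] := ltnP (mdeg m) D.*2.
    by rewrite mcoeffD mcoeffZ -(hw (BMultinom mD)).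
  rewrite mcoeff_gram_large//; apply/eqP; rewrite mcoeff_eq0.
  exact/msize_mdeg_ge/(leq_trans (ptD t)).
rewrite SE in S0 *; apply: cone_min S0.
- rewrite (_ : K = (\bigcap_(ij in setT)
      [set w : 'rV[R]_(N * N) | vec_mx w ij.1 ij.2 - vec_mx w ij.2 ij.1 = 0])
    `&` \bigcap_(v in setT) [set w | 0 <= qform (vec_mx w) v]).
    apply: closedI; [apply: closed_bigI => -[i j] _ /= | apply: closed_bigI => v _ /=].
      apply: (closed_preimage _ _ (fun w : 'rV[R]_(N * N) => _) [set 0]).
        move=> w; apply: (@continuousB _ _ _
          (fun w : 'rV[R]_(N * N) => vec_mx w i j) (fun w => vec_mx w j i)).
          exact: vec_mx_continuous.
        exact: vec_mx_continuous.
      exact: closed_eq.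
    apply: (closed_preimage _ _ (fun w => qform (vec_mx w) v) [set x | 0 <= x]).
      exact: qform_continuous.
    exact: closed_ge.
  apply/seteqP; split => w /= [H1 H2].
    split => [[i j] _|v _] /=; last exact: H2.
    by rewrite -{1}H1 mxE subrr.
  split => [|v]; last exact: H2.
  by apply/matrixP => i j; rewrite mxE; apply/eqP; rewrite -subr_eq0 (H1 (j, i)).
- move=> c w c0 [symw psdw]; rewrite /K/= linearZ/= linearZ/= symw; split => // v.
  by rewrite -scalemxAr -scalemxAl mxE mulr_ge0.
- move=> m; rewrite (_ : h m = fun w => \sum_a \sum_b w 0 (mxvec_index a b) *
      mcoeff m (mpolyX R (bmnm (enum_val a)) * mpolyX R (bmnm (enum_val b)))).
    apply: continuous_big => [|a _]; first exact: add_continuous.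
    apply: continuous_big => [|b _ w]; first exact: add_continuous.
    apply: (@continuousM _ _ (fun w : 'rV_(N * N) => w 0 (mxvec_index a b)) (cst _)).
      exact: coord_continuous.
    exact: cst_continuous.
  apply/funext => w; rewrite /h mcoeff_gram; apply: eq_bigr => a _.
  by apply: eq_bigr => b _; rewrite mxE.
- move=> m c w; rewrite /h !mcoeff_gram mulr_sumr; apply: eq_bigr => a _.
  by rewrite mulr_sumr; apply: eq_bigr => b _; rewrite linearZ mxE mulrA.
- move=> w [symw psdw] hw; apply: (can_inj (@vec_mxK _ N N)); rewrite linear0.
  apply: gram_eq0 => //; apply/mpolyP => m; rewrite mcoeff0.
  have [mD|Dm] := ltnP (mdeg m) D.*2; first exact: (hw (BMultinom mD)).
  exact: mcoeff_gram_large.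
Qed.

End SosMinimum.

(** * The Taylor model *)

Section DominatedDerivatives.
Context {R : realType} {n k : nat}.
Local Notation A := (mpoly k R).
Implicit Types (Z V : 'I_n -> A) (s pre : seq 'I_n).

(** [pre] accumulates the letters already passed by the recursion of [mono_d1]. One more letter
    turns into a V, so every monomial keeps between 1 and 2e letters in Z, the range of
    [dominated_mono]. *)
Lemma dominated_d1 e pre s a : (2 <= size pre + size s <= e.*2.+1)%N ->
  dominated e (fun Z V : 'I_n -> A =>
    (\prod_(i <- pre) Z i) * (V a * mono_d1 s Z V)).
Proof.
elim: s pre => [|b s IH] pre /= sz.
  apply: (eq_dominated _ _ _ _ (dominated0 e)) => Z V /=.
  by rewrite !mulr0.
apply: (eq_dominated _ (fun Z V => (\prod_(i <- pre ++ s) Z i) * V a * V b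
    + (\prod_(i <- b :: pre) Z i) * (V a * mono_d1 s Z V))).
  by move=> Z V; rewrite big_cat big_cons /=; ring.
apply: dominatedD; first by apply: dominated_mono; rewrite size_cat; lia.
by apply: IH => /=; lia.
Qed.

(** Here two letters of the word turn into V, hence both bounds are those of [dominated_mono]
    shifted by two. *)
Lemma dominated_d2 e pre s : (3 <= size pre + size s <= e.*2.+2)%N ->
  dominated e (fun Z V : 'I_n -> A => (\prod_(i <- pre) Z i) * mono_d2 s Z V).
Proof.
elim: s pre => [|b s IH] pre /= sz.
  apply: (eq_dominated _ _ _ _ (dominated0 e)) => Z V /=.
  by rewrite !mulr0.
have dw : dominated e (fun Z V : 'I_n -> A =>
    (\prod_(i <- pre) Z i) * (V b * mono_d1 s Z V)).
  by apply: dominated_d1; lia.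
apply: (eq_dominated _ _ _ _ (dominatedD _ _ _ (dominatedD _ _ _ dw dw)
  (IH (b :: pre) _))); last by rewrite /=; lia.
by move=> Z V; rewrite big_cons /=; ring.
Qed.

End DominatedDerivatives.

Section Model.
Context {R : realType} {n : nat}.
Variable f : 'rV[R]_n -> R.
Implicit Types (x y : 'rV[R]_n).

Local Notation ev x := (meval (fun i => x 0 i)).

Section AlongMorphism.
Context {A : comNzRingType} (phi : {rmorphism mpoly n R -> A}) (v : 'I_n -> A).

Local Notation term c := (phi (mpolyC n c)).

Lemma dir1_taylor d x : dir1 phi v (taylor f d x) =
  \sum_(k < d.+1) \sum_(s : k.-tuple 'I_n)
    term ((k`!%:R)^-1 * partial f s x) * mono_d1 s (fun i => phi (pshift x i)) v.
Proof.
rewrite dir1_sum; apply: eq_bigr => k _.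
rewrite dir1Z dir1_sum mulr_sumr; apply: eq_bigr => s _.
by rewrite dir1Z dir1_mono mpolyCM rmorphM mulrA.
Qed.

Lemma dir2_taylor d x : dir2 phi v (taylor f d x) =
  \sum_(k < d.+1) \sum_(s : k.-tuple 'I_n)
    term ((k`!%:R)^-1 * partial f s x) * mono_d2 s (fun i => phi (pshift x i)) v.
Proof.
rewrite dir2_sum; apply: eq_bigr => k _.
rewrite dir2Z dir2_sum mulr_sumr; apply: eq_bigr => s _.
by rewrite dir2Z dir2_mono mpolyCM rmorphM mulrA.
Qed.

(** The guard zeroes the low orders without reindexing, so the remainder keeps the coefficients that
    [taylor_coef_bound] controls. *)
Lemma dir1_taylor_split d x : dir1 phi v (taylor f d.+1 x) =
  \sum_i term (grad f x 0 i) * v i +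
  \sum_(k < d.+2) \sum_(s : k.-tuple 'I_n)
    term ((k`!%:R)^-1 * partial f s x) *
      (if (1 < k)%N then mono_d1 s (fun i => phi (pshift x i)) v else 0).
Proof.
rewrite dir1_taylor 4!big_ord_recl/= !addrA; congr (_ + _).
rewrite [X in X + _]big1 ?add0r => [|s _]; last by rewrite tuple0 mulr0.
rewrite [X in _ = _ + X + _]big1 ?addr0 => [|s _]; last by rewrite mulr0.
rewrite [X in _ = _ + X]big1 ?addr0 => [|s _]; last by rewrite mulr0.
rewrite (reindex (fun i => [tuple i]))/=; last first.
  exists (fun s : 1.-tuple 'I_n => tnth s ord0) => [i _|s _]; first by [].
  by apply/val_inj; case: s => [[|a []]].
apply: eq_bigr => i _; rewrite big_nil mulr1 mulr0 addr0.
by rewrite mxE invr1 mul1r.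
Qed.

Lemma dir2_taylor_split d x : dir2 phi v (taylor f d.+2 x) =
  \sum_i \sum_j term (hess f x i j) * v i * v j +
  \sum_(k < d.+3) \sum_(s : k.-tuple 'I_n)
    term ((k`!%:R)^-1 * partial f s x) *
      (if (2 < k)%N then mono_d2 s (fun i => phi (pshift x i)) v else 0).
Proof.
rewrite dir2_taylor 6!big_ord_recl/= !addrA; congr (_ + _).
rewrite [X in X + _ + _]big1 ?add0r => [|s _]; last by rewrite tuple0 mulr0.
rewrite [X in X + _]big1 ?add0r => [|s _]; last first.
  by case: s => [[|a []]]//= _; rewrite mulr0 mul0rn mulr0 addr0 mulr0.
rewrite [X in _ = _ + X]big1 ?addr0 => [|s _]; last by rewrite mulr0.
rewrite [X in _ = _ + X]big1 ?addr0 => [|s _]; last by rewrite mulr0.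
rewrite [X in _ = _ + X]big1 ?addr0 => [|s _]; last by rewrite mulr0.
(* Order 2 is a sum over pairs of indices; on two letters [mono_d2] carries a factor 2, which
   cancels 1 / 2!. *)
rewrite (reindex (fun p : 'I_n * 'I_n => [tuple p.1; p.2]))/=; last first.
  exists (fun s : 2.-tuple 'I_n => (tnth s ord0, tnth s ord_max)) => [[i j] _|s _] //.
  by apply/val_inj; case: s => [[|a [|b []]]].
rewrite pair_bigA; apply: eq_bigr => -[i j] _ /=.
rewrite mxE !mulr0 !addr0 !big_nil mulr1 mul0rn mulr0 addr0 -mulrA.
rewrite -[(v i * v j) *+ 2]mulr_natl mulrA; congr (_ * _).
rewrite -(rmorph_nat phi) -rmorphM; congr (phi _).
rewrite -(rmorph_nat (@mpolyC n R)) -mpolyCM; congr (mpolyC _ _).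
by rewrite mulrC mulrA divff ?mul1r// pnatr_eq0.
Qed.

End AlongMorphism.
End Model.

Section ModelEstimates.
Context {R : realType} {n : nat}.
Variables (f : 'rV[R]_n -> R) (xs : 'rV[R]_n).
Implicit Types (x y : 'rV[R]_n).

Local Notation ev x := (meval (fun i => x 0 i)).
Local Notation "c %:C" := (@mpolyC (n + n) R c) (at level 2).

(** The displacement z = y - x in the ring of [hess_form], where y stands for the first block of
    variables and the direction v for the second. *)
Definition base_vars x (i : 'I_n) : mpoly (n + n) R :=
  comp_mpoly [tuple pvar (lshift n k) | k < n] (pshift x i).

Definition dir_vars (i : 'I_n) : mpoly (n + n) R := pvar (rshift n i).

Lemma taylor_coef_bound d :
  (forall s : seq 'I_n, (size s <= d)%N -> continuous (partial f s)) ->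
  exists2 M, 0 <= M & \forall x \near xs, forall (k : 'I_d.+1) (s : k.-tuple 'I_n),
    `|(k`!%:R)^-1 * partial f s x| <= M.
Proof.
move=> cf; pose c (k : 'I_d.+1) (s : k.-tuple 'I_n) x := (k`!%:R)^-1 * partial f s x.
have cc k s : continuous (c k s).
  move=> x; apply: (@continuousM _ _ (cst _) (partial f s)).
    exact: cst_continuous.
  by apply: cf; rewrite size_tuple -ltnS.
pose M := \sum_k \sum_s (`|c k s xs| + 1).
have M0 k s : 0 <= `|c k s xs| + 1 by rewrite addr_ge0.
exists M; first by apply: sumr_ge0 => k _; exact: sumr_ge0.
apply: (@filter_forall _ _ (fun k x => forall s, `|c k s x| <= M) (nbhs xs)) => k.
apply: (@filter_forall _ _ (fun s x => `|c k s x| <= M) (nbhs xs)) => s.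
have := cc k s xs => /cvgr_norm_le /(_ (`|c k s xs| + 1)).
rewrite ltrDl => /(_ ltr01); apply: filterS => x /le_trans; apply.
rewrite /M (bigD1 k)//= (bigD1 s)//= -addrA lerDl addr_ge0//.
  exact: sumr_ge0.
by apply: sumr_ge0 => l _; exact: sumr_ge0.
Qed.

(** The Hessian of f contributes mu |v|^2 at least; half of it pays for the terms of order above 2,
    and the other half is left as a margin of convexity. *)
Lemma taylor_hess_sos d e mu : 0 < mu -> (2 <= d <= e.*2.+2)%N ->
  (forall s : seq 'I_n, (size s <= d)%N -> continuous (partial f s)) ->
  (forall x, psdmx (hess f x - mu%:M)) ->
  exists2 K, 0 <= K & \forall x \near xs,
    sos (hess_form (taylor f d x)
       + (K%:C * sqs (base_vars x) ^+ e - (mu / 2)%:C) * sqs dir_vars).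
Proof.
move=> mu0 /andP[d2 de] cf psdf; case: d d2 de cf => [|[|d]]// _ de cf.
have [M M0 HM] := taylor_coef_bound d.+2 cf.
(* Orders and index words are merged into one finite type, as [dominated_sum] treats a single list
   of terms. *)
pose I := {k : 'I_d.+3 & k.-tuple 'I_n}.
pose w (p : I) (Z V : 'I_n -> mpoly (n + n) R) :=
  if (2 < tag p)%N then mono_d2 (tagged p) Z V else 0.
have dw p : dominated e (w p).
  rewrite /w; have [p3|_] := ltnP 2 (tag p); last exact: dominated0.
  apply: (eq_dominated _ (fun Z V => (\prod_(i <- [::]) Z i) * mono_d2 (tagged p) Z V)).
    by move=> Z V; rewrite big_nil mul1r.
  by apply: dominated_d2; rewrite /= size_tuple p3; have := ltn_ord (tag p); lia.
have mu20 : 0 < mu / 2 by rewrite divr_gt0.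
have [K K0 HK] := dominated_sum e I (index_enum I) w M _ dw mu20.
exists K => //; near=> x.
have HMx : forall (k : 'I_d.+3) (s : k.-tuple 'I_n),
    `|(k`!%:R)^-1 * partial f s x| <= M by near: x.
pose c (p : I) := ((tag p)`!%:R)^-1 * partial f (tagged p) x.
have cM p : `|c p| <= M by exact: HMx.
have := HK c (base_vars x) dir_vars cM; set S := sqs _; set V2 := sqs dir_vars.
move=> sd; have := sosD _ _ (sos_qform (n + n) _ dir_vars (psdf x)) sd; congr sos.
have -> : hess_form (taylor f d.+2 x)
    = \sum_i \sum_j (hess f x i j)%:C * dir_vars i * dir_vars j
    + \sum_p (c p)%:C * w p (base_vars x) dir_vars.
  rewrite [LHS](dir2_taylor_split f (comp_mpoly [tuple pvar (lshift n k) | k < n])).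
  congr (_ + _).
    by apply: eq_bigr => i _; apply: eq_bigr => j _; rewrite /= comp_mpolyC.
  by rewrite [LHS]sig_big_dep; apply: eq_bigr => p _; rewrite /= comp_mpolyC.
have -> : \sum_i \sum_j ((hess f x - mu%:M) i j)%:C * dir_vars i * dir_vars j
    = \sum_i \sum_j (hess f x i j)%:C * dir_vars i * dir_vars j - mu%:C * V2.
  rewrite /V2 /sqs mulr_sumr -sumrB; apply: eq_bigr => i _.
  rewrite [in RHS](bigD1 i)//= [in LHS](bigD1 i)//= !mxE eqxx mulr1n.
  rewrite -!addrA [X in _ = _ + X]addrC !addrA; congr (_ + _).
    by rewrite mpolyCB; ring.
  apply: eq_bigr => j ji; rewrite !mxE eq_sym (negbTE ji) mulr0n.
  by rewrite subr0.
have {1}-> : mu = mu / 2 + mu / 2 by field.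
rewrite mpolyCD /w /c /base_vars -/S.
set Q := \sum_i _; set W := \sum_i _; ring.
Unshelve. all: by end_near.
Qed.

End ModelEstimates.

(** * Convexity of the regularized model *)

Section RegularizedModel.
Context {R : realType} {n : nat}.
Variables (f : 'rV[R]_n -> R) (d d' e : nat).
Hypothesis d'E : d'./2 = e.+2.
Implicit Types (x y xs : 'rV[R]_n) (t K mu eta : R).

Local Notation ev x := (meval (fun i => x 0 i)).
Local Notation "c %:C" := (@mpolyC (n + n) R c) (at level 2).

Definition sqnorm (v : 'I_n -> R) := \sum_i v i ^+ 2.

(** Since d' = 2(e + 2), the power e.+1 of |z|^2 is |z|^(d'-2), the factor of |v|^2 in the Hessian
    form of [reg]. *)
Definition hess_dominated mu K x :=
  sos (hess_form (taylor f d x)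
     + (K%:C * sqs (base_vars x) ^+ e.+1 - (mu / 2)%:C) * sqs dir_vars).

Lemma hess_form_psi x t :
  hess_form (psi f d d' x t) = hess_form (taylor f d x) + t *: hess_form (reg d' x).
Proof.
pose phi := comp_mpoly [tuple pvar (lshift n k : 'I_(n + n)) | k < n] : _ -> mpoly (n + n) R.
have hE p : hess_form p = dir2 phi dir_vars p by [].
by rewrite !hE dir2D dir2Z /= /phi comp_mpolyC mul_mpolyC.
Qed.

Lemma hess_form_reg x : hess_form (reg d' x) =
  (sqs (base_vars x) ^+ e.+1 * sqs dir_vars) *+ e.+2.*2 +
  (sqs (base_vars x) ^+ e * (\sum_i base_vars x i * dir_vars i) ^+ 2)
    *+ (4 * (e.+2 * e.+1)).
Proof. by rewrite /reg d'E; exact: dir2_reg. Qed.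

Lemma sosconvex_psi mu K x : 0 <= mu -> 0 <= K -> hess_dominated mu K x ->
  sosconvex (psi f d d' x K).
Proof.
move=> mu0 K0 H; rewrite /sosconvex hess_form_psi hess_form_reg.
move: H; rewrite /hess_dominated.
set T := hess_form _; set S := sqs _; set V2 := sqs _; set W := _ ^+ 2 => H.
have sS : sos S by exact: sos_sqs.
have sV : sos V2 by exact: sos_sqs.
(* One of the 2(e + 2) copies of S^(e+1) |v|^2 pays for the K term of the certificate; what remains
   is visibly SOS. *)
have -> : T + K *: (S ^+ e.+1 * V2 *+ e.+2.*2 + S ^+ e * W *+ (4 * (e.+2 * e.+1)))
  = T + (K%:C * S ^+ e.+1 - (mu / 2)%:C) * V2
    + (mu / 2)%:C * V2 + K *: (S ^+ e.+1 * V2 *+ (e.+1.*2.+1))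
    + K *: (S ^+ e * W *+ (4 * (e.+2 * e.+1))).
  rewrite doubleS [_ *+ _.+2]mulrS -!mul_mpolyC; ring.
apply: sosD; last first.
  by apply/sosZ/sosMn/sosM => //; [exact: sosX|exact: sos_sqr].
apply: sosD; last by apply/sosZ/sosMn/sosM => //; exact: sosX.
by apply: sosD => //; apply: sosM => //; apply: sosC; rewrite divr_ge0.
Qed.

Lemma exists_tmin mu K x : 0 <= mu -> 0 <= K -> hess_dominated mu K x ->
  exists2 t, is_tmin f d d' x t & t <= K.
Proof.
move=> mu0 K0 H; have SK := sosconvex_psi _ _ _ mu0 K0 H.
have [|t [t0 St] lt] := sos_min (hess_form (taylor f d x)) (hess_form (reg d' x)).
  by exists K; split => //; rewrite -hess_form_psi.
exists t; last by apply: lt; split => //; rewrite -hess_form_psi.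
split; first by split; [exact: t0 | rewrite /sosconvex hess_form_psi; exact: St].
by move=> s [s0 Ss]; apply: lt; split => //; rewrite -hess_form_psi.
Qed.

Lemma eval_pshift x y : (fun i => ev y (pshift x i)) = (fun i => (y - x) 0 i).
Proof.
by apply/funext => i; rewrite /pshift rmorphB/= /pvar mevalXU mevalC !mxE.
Qed.

(** The certificate is evaluated at (y, v). The regularizer only adds a nonnegative amount, so the
    bound does not depend on t. *)
Lemma psi_hess_lower mu K x t y (v : 'I_n -> R) : 0 <= t -> hess_dominated mu K x ->
  (mu / 2 - K * sqnorm (fun i => (y - x) 0 i) ^+ e.+1) * sqnorm v
    <= dir2 (ev y) v (psi f d d' x t).
Proof.
move=> t0 [s sE]; rewrite dir2D dir2Z.
have : 0 <= peval (\sum_(q <- s) q ^+ 2) (row_mx y (\row_i v i)).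
  by rewrite /peval rmorph_sum; apply: sumr_ge0 => q _; rewrite rmorphXn sqr_ge0.
rewrite -sE [peval _ _]rmorphD/= [meval _ (hess_form _)]hess_form_dir2.
rewrite rmorphM rmorphB rmorphM rmorphXn/= !mevalC.
have -> : meval (fun i => row_mx y (\row_i v i) 0 i) (sqs dir_vars) = sqnorm v.
  rewrite rmorph_sum; apply: eq_bigr => i _.
  by rewrite rmorphXn/= /dir_vars /pvar mevalXU row_mxEr mxE.
have -> : meval (fun i => row_mx y (\row_i v i) 0 i) (sqs (base_vars x))
    = sqnorm (fun i => (y - x) 0 i).
  rewrite rmorph_sum; apply: eq_bigr => i _; rewrite rmorphXn/= /base_vars.
  rewrite comp_mpoly_meval; congr (_ ^+ 2).
  rewrite -[RHS](congr1 (@^~ i) (eval_pshift x y)); apply: meval_eq => k.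
  by rewrite tnth_mktuple /pvar mevalXU row_mxEl.
have : 0 <= t * dir2 (ev y) v (reg d' x).
  rewrite mulr_ge0// /reg d'E dir2_reg addr_ge0// mulrn_wge0// mulr_ge0//.
  - by apply: exprn_ge0; apply: sumr_ge0 => i _; exact: sqr_ge0.
  - by apply: sumr_ge0 => i _; exact: sqr_ge0.
  - by apply: exprn_ge0; apply: sumr_ge0 => i _; exact: sqr_ge0.
  - exact: sqr_ge0.
set a := dir2 _ _ _; set b := t * _; set c := sqnorm _ ^+ _; set u := sqnorm v.
have -> : (fun i => (\row_i v i) 0 i) = v.
  by apply/funext => i; rewrite mxE.
rewrite -/a => b0 ?; lra.
Qed.

End RegularizedModel.

(** * Gradient of the model near the solution *)

Section ModelGradient.
Context {R : realType} {n : nat}.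
Variables (f : 'rV[R]_n -> R) (d d' e : nat).
Hypothesis d'E : d'./2 = e.+2.
Implicit Types (x y xs : 'rV[R]_n).

Local Notation ev x := (meval (fun i => x 0 i)).

Lemma mono_d1_continuous (s : seq 'I_n) (v : 'I_n -> R) :
  continuous (fun z : 'rV[R]_n => mono_d1 s (fun i => z 0 i) v).
Proof.
elim: s => [|a s IH] /=; first exact: cst_continuous.
have cprod : continuous (fun z : 'rV[R]_n => \prod_(b <- s) z 0 b).
  apply: continuous_big => [|b _]; [exact: mul_continuous|exact: coord_continuous].
move=> z; apply: (@continuousD _ _ _ (fun z : 'rV[R]_n => v a * \prod_(b <- s) z 0 b)
  (fun z : 'rV[R]_n => z 0 a * mono_d1 s (fun i => z 0 i) v)).
  apply: (@continuousM _ _ (cst (v a))); [exact: cst_continuous|exact: cprod].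
apply: (@continuousM _ _ (fun z : 'rV[R]_n => z 0 a)); last exact: IH.
exact: coord_continuous.
Qed.

Lemma mono_d1_0 (s : seq 'I_n) (v : 'I_n -> R) : (1 < size s)%N ->
  mono_d1 s (fun=> 0) v = 0.
Proof. by case: s => [|a [|b s]]//= _; rewrite big_cons !mul0r mulr0 addr0. Qed.

(** The gradient of the model at y is that of f at x plus terms in z = y - x that vanish at 0, with
    coefficients bounded by M and K. The continuous function [Q] of z dominates them all, whence
    uniformity in x, y and t. *)
Lemma psi_grad_near_succ xs (K eta : R) : 0 < eta ->
  (forall s : seq 'I_n, (size s <= d.+1)%N -> continuous (partial f s)) ->
  exists2 dl, 0 < dl & forall x y t, `|x - xs| < dl -> `|y - xs| < dl -> 0 <= t <= K ->
    forall i, `|peval (mderiv i (psi f d.+1 d' x t)) y - grad f xs 0 i| <= eta.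
Proof.
move=> eta0 cf; have [M M0 HM] := taylor_coef_bound f xs d.+1 cf.
pose unit_vec (i j : 'I_n) : R := (j == i)%:R.
pose q i (k : 'I_d.+2) (s : k.-tuple 'I_n) (z : 'rV[R]_n) : R :=
  if (1 < k)%N then mono_d1 s (fun i => z 0 i) (unit_vec i) else 0.
pose r i (z : 'rV[R]_n) : R :=
  (sqnorm (fun i => z 0 i) ^+ e.+1 * z 0 i) *+ e.+2.*2.
pose Q z := \sum_i ((\sum_k \sum_s `|q i k s z|) + `|r i z|).
have cq i k s : continuous (q i k s).
  rewrite /q; case: (ltnP 1 k) => _; first exact: mono_d1_continuous.
  exact: cst_continuous.
have cr i : continuous (r i).
  have [p pE] : exists p, r i = peval p.
    exists (((\sum_j pvar j ^+ 2) ^+ e.+1 * pvar i) *+ e.+2.*2).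
    apply/funext => z; rewrite /peval rmorphMn rmorphM rmorphXn rmorph_sum/=.
    rewrite /pvar mevalXU /r /sqnorm; congr (_ ^+ _ * _ *+ _); apply: eq_bigr => j _.
    by rewrite rmorphXn/= mevalXU.
  by rewrite pE; exact: peval_continuous.
have cnorm (h : 'rV[R]_n -> R) : continuous h -> continuous (fun z => `|h z|).
  move=> ch z; apply: (@continuous_comp _ _ _ h Num.norm); first exact: ch.
  exact: norm_continuous.
have cQ : continuous Q.
  apply: continuous_big => [|i _ z]; first exact: add_continuous.
  apply: (@continuousD _ _ _ (fun z => \sum_k \sum_s `|q i k s z|) (fun z => `|r i z|)).
    apply: continuous_big => [|k _]; first exact: add_continuous.
    apply: continuous_big => [|s _]; first exact: add_continuous.
    exact: cnorm.
  exact: cnorm.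
have q0 i k s : q i k s 0 = 0.
  rewrite /q; case: ltnP => // k1; rewrite (_ : (fun j => _) = fun=> 0).
    by rewrite mono_d1_0// size_tuple.
  by apply/funext => j; rewrite mxE.
have Q0 : Q 0 = 0.
  rewrite /Q big1// => i _; rewrite /r mxE mulr0 mul0rn normr0 addr0 big1// => k _.
  by rewrite big1// => s _; rewrite q0 normr0.
have Qge i z : (\sum_k \sum_s `|q i k s z|) + `|r i z| <= Q z.
  rewrite /Q (bigD1 i)//= lerDl; apply: sumr_ge0 => j _.
  by apply: addr_ge0 => //; apply: sumr_ge0 => k _; exact: sumr_ge0.
(* M bounds the Taylor coefficients and |K| the parameter t; the 1 makes L positive. *)
pose L := M + `|K| + 1; have L0 : 0 < L.
  by rewrite /L addrAC ltr_wpDr// ltr_wpDl.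
have Qsmall : \forall z \near (0 : 'rV[R]_n), `|Q z| <= eta / 2 / L.
  have := cQ 0 => /cvgr_norm_le /(_ (eta / 2 / L)); rewrite Q0 normr0; apply.
  by rewrite !divr_gt0.
have gsmall : \forall x \near xs, forall i, `|grad f xs 0 i - grad f x 0 i| <= eta / 2.
  apply: (@filter_forall _ _
    (fun i x => `|grad f xs 0 i - grad f x 0 i| <= eta / 2) (nbhs xs)) => i.
  have cg : continuous (fun x => grad f x 0 i).
    rewrite (_ : (fun x => _) = partial f [:: i]); first exact: cf.
    by apply/funext => x; rewrite mxE.
  have := cg xs => /cvgr_dist_le; apply; exact: divr_gt0.
have /nbhs_ballP[d1 /= d10 H1] := HM.
have /nbhs_ballP[d2 /= d20 H2] := Qsmall.
have /nbhs_ballP[d3 /= d30 H3] := gsmall.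
(* y - x is a difference of two deviations from [xs], hence d2 / 2. *)
exists (Num.min d1 (Num.min (d2 / 2) d3)); first by rewrite !lt_min d10 d30 divr_gt0.
move=> x y t; rewrite !lt_min => /and3P[x1 x2 x3] /and3P[_ y2 _] /andP[t0 tK] i.
have {}H1 := H1 x; have {}H3 := H3 x; have {}H2 := H2 (y - x).
rewrite -!ball_normE /ball_/= in H1 H2 H3.
rewrite distrC in x1; rewrite distrC in x3; have {}H1 := H1 x1; have {}H3 := H3 x3.
have {}H2 : `|Q (y - x)| <= eta / 2 / L.
  apply: H2; rewrite sub0r normrN (_ : y - x = (y - xs) - (x - xs)); last first.
    by rewrite opprB addrA subrK.
  by rewrite (le_lt_trans (ler_normB _ _))// [ltRHS](splitr d2) ltrD.
have -> : peval (mderiv i (psi f d.+1 d' x t)) y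
    = dir1 (ev y) (unit_vec i) (psi f d.+1 d' x t).
  rewrite /dir1 (bigD1 i)//= /unit_vec eqxx mulr1 big1 ?addr0// => j /negbTE ->.
  by rewrite mulr0.
rewrite dir1D dir1Z dir1_taylor_split /reg d'E dir1_reg/= mevalC.
have sum_unit (F : 'I_n -> R) : \sum_j F j * unit_vec i j = F i.
  rewrite (bigD1 i)//= /unit_vec eqxx mulr1 big1 ?addr0// => j /negbTE ->.
  by rewrite mulr0.
rewrite !sum_unit mevalC.
set A := \sum_(k < d.+2) _.
have Ale : `|A| <= M * \sum_k \sum_s `|q i k s (y - x)|.
  rewrite mulr_sumr; apply: le_trans (ler_norm_sum _ _ _) _; apply: ler_sum => k _.
  rewrite mulr_sumr; apply: le_trans (ler_norm_sum _ _ _) _; apply: ler_sum => s _.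
  rewrite mevalC normrM eval_pshift ler_wpM2r//; exact: H1.
rewrite (_ : _ *+ _ = r i (y - x)); last first.
  have evp j : ev y (pshift x j) = (y - x) 0 j.
    exact: (congr1 (@^~ j) (eval_pshift x y)).
  rewrite /r /sqnorm evp; congr (_ ^+ _ * _ *+ _); apply: eq_bigr => j _.
  by rewrite evp.
have rle : `|t * r i (y - x)| <= `|K| * `|r i (y - x)|.
  by rewrite normrM ler_wpM2r// ger0_norm// (le_trans tK)// ler_norm.
have LQ : L * Q (y - x) <= eta / 2.
  rewrite mulrC -ler_pdivlMr//; apply: le_trans H2; exact: ler_norm.
have := Qge i (y - x); set q1 := \sum_k _ in Ale *; set r1 := `|r _ _| in rle * => qr.
have q10 : 0 <= q1 by apply: sumr_ge0 => k _; exact: sumr_ge0.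
have r10 : 0 <= r1 by exact: normr_ge0.
have Qb : M * q1 + `|K| * r1 <= L * Q (y - x).
  apply: (@le_trans _ _ (L * (q1 + r1))); last by rewrite ler_wpM2l// ltW.
  rewrite mulrDr lerD// ler_wpM2r// /L; first by rewrite -addrA lerDl addr_ge0.
  by rewrite addrAC lerDr addr_ge0.
rewrite (_ : _ - _ = A + t * r i (y - x) - (grad f xs 0 i - grad f x 0 i)); last by ring.
apply: le_trans (ler_normB _ _) _.
have := ler_normD A (t * r i (y - x)); have := H3 i; lra.
Qed.

End ModelGradient.

Lemma psi_grad_near {R : realType} {n : nat} (f : 'rV[R]_n -> R) (d d' e : nat) :
  d'./2 = e.+2 -> forall (xs : 'rV[R]_n) (K eta : R), (0 < d)%N -> 0 < eta ->
  (forall s : seq 'I_n, (size s <= d)%N -> continuous (partial f s)) ->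
  exists2 dl, 0 < dl & forall x y t, `|x - xs| < dl -> `|y - xs| < dl -> 0 <= t <= K ->
    forall i, `|peval (mderiv i (psi f d d' x t)) y - grad f xs 0 i| <= eta.
Proof. by case: d => // d d'E xs K eta _; apply: (psi_grad_near_succ f d d' e d'E). Qed.

(** * Constrained minimization *)

Section ConstrainedMinimizer.
Context {R : realType} {n m : nat}.
Implicit Types (F : mpoly n R) (g : 'I_m -> mpoly n R) (x y u xs : 'rV[R]_n).

Local Notation ev x := (meval (fun i => x 0 i)).
Local Notation coords u := (fun i => u 0 i).

Lemma sqnorm_ge0 (v : 'I_n -> R) : 0 <= sqnorm v.
Proof. by apply: sumr_ge0 => i _; exact: sqr_ge0. Qed.

Lemma sqnormZ t u : sqnorm (coords (t *: u)) = t ^+ 2 * sqnorm (coords u).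
Proof. by rewrite /sqnorm mulr_sumr; apply: eq_bigr => i _; rewrite mxE exprMn. Qed.

Lemma sqnorm_eq0 u : sqnorm (coords u) = 0 -> u = 0.
Proof.
move=> /eqP; rewrite psumr_eq0 => [/allP H|i _]; last exact: sqr_ge0.
apply/rowP => i; rewrite mxE; have /= := H i (mem_index_enum i).
by rewrite sqrf_eq0 => /eqP.
Qed.

Lemma sqnorm_enorm u : sqnorm (coords u) = enorm u ^+ 2.
Proof. by rewrite /enorm sqr_sqrtr//; exact: sqnorm_ge0. Qed.

Lemma sqnorm_half_sum x y :
  sqnorm (coords (x + y)) <= 2 * sqnorm (coords x) + 2 * sqnorm (coords y).
Proof.
rewrite /sqnorm !mulr_sumr -big_split; apply: ler_sum => i _ /=; rewrite mxE.
have : 0 <= (x 0 i - y 0 i) ^+ 2 by exact: sqr_ge0.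
by nra.
Qed.

Lemma coord_le_sqnorm u (rho : R) i : 0 <= rho -> sqnorm (coords u) <= rho ^+ 2 ->
  `|u 0 i| <= rho.
Proof.
move=> rho0 H; rewrite -(@ler_pXn2r _ 2)// ?nnegrE// real_normK ?num_real//.
apply: le_trans H; rewrite /sqnorm (bigD1 i)//= lerDl.
by apply: sumr_ge0 => j _; exact: sqr_ge0.
Qed.

Lemma norm_le_sqnorm u (rho : R) : 0 <= rho -> sqnorm (coords u) <= rho ^+ 2 -> `|u| <= rho.
Proof.
move=> rho0 H; rewrite [`|u|]mx_normrE; apply/bigmax_leP; split => //= -[i j] _ /=.
by rewrite ord1; exact: coord_le_sqnorm.
Qed.

Lemma sqnorm_continuous xs : continuous (fun y => sqnorm (coords (y - xs))).
Proof.
apply: continuous_big => [|i _]; first exact: add_continuous.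
have [p pE] : exists p, (fun y : 'rV[R]_n => (y - xs) 0 i ^+ 2) = peval p.
  exists (pshift xs i ^+ 2); apply/funext => y.
  by rewrite /peval rmorphXn/= -(congr1 (@^~ i) (eval_pshift xs y)).
by rewrite pE; exact: peval_continuous.
Qed.

Lemma feasible_convex g x y t : (forall k, sosconvex (g k)) -> feasible g x ->
  feasible g y -> 0 <= t <= 1 -> feasible g (x + t *: (y - x)).
Proof.
move=> cg Cx Cy t01 k; apply: le_trans (sosconvex_convex _ x y t (cg k) t01) _.
have /andP[t0 t1] := t01.
have := ler_wpM2l t0 (Cy k); have t1' : 0 <= 1 - t by rewrite subr_ge0.
have := ler_wpM2l t1' (Cx k); lra.
Qed.

Lemma feasible_closed g : closed (feasible g).
Proof.
rewrite (_ : feasible g = \bigcap_(k in setT) (peval (g k) @^-1` [set x | x <= 0])).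
  apply: closed_bigI => k _; apply: closed_preimage; last exact: closed_le.
  exact: peval_continuous.
by apply/seteqP; split => [x H k _|x H k]; [exact: H|exact: H].
Qed.

(** On the sphere of radius rho, the quadratic gain c rho^2 / 2 beats the gradient error, at most n
    eta rho because every |v_i| <= rho. *)
Lemma growth_of_hessian F xs (gam : 'I_n -> R) (c rho eta : R) (v : 'rV[R]_n) :
  0 < rho -> 0 < c -> n%:R * eta < c * rho / 2 -> 0 <= eta ->
  (forall y, sqnorm (coords (y - xs)) <= rho ^+ 2 ->
    forall w, c * sqnorm w <= dir2 (ev y) w F) ->
  (forall i, `|peval (mderiv i F) xs - gam i| <= eta) ->
  sqnorm (coords v) = rho ^+ 2 -> 0 <= \sum_i gam i * v 0 i ->
  peval F xs < peval F (xs + v).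
Proof.
move=> rho0 c0 neta eta0 HF Hg vrho gv.
have D : - (n%:R * eta * rho) <= dir1 (ev xs) (coords v) F.
  have -> : dir1 (ev xs) (coords v) F = \sum_i gam i * v 0 i
      + \sum_i (peval (mderiv i F) xs - gam i) * v 0 i.
    by rewrite -big_split; apply: eq_bigr => i _ /=; rewrite -mulrDl addrC subrK.
  have le : `|\sum_i (peval (mderiv i F) xs - gam i) * v 0 i| <= n%:R * eta * rho.
    apply: le_trans (ler_norm_sum _ _ _) _.
    apply: (@le_trans _ _ (\sum_(i < n) eta * rho)); last first.
      by rewrite sumr_const card_ord -[(eta * rho) *+ n]mulr_natl mulrA.
    apply: ler_sum => i _; rewrite normrM ler_pM//.
    by apply: coord_le_sqnorm; [exact: ltW | rewrite vrho].
  move: le; rewrite ler_norml => /andP[le _]; lra.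
have lt2 : n%:R * eta * rho < c * rho / 2 * rho by rewrite ltr_pM2r.
have H := peval_second_order F xs v (c * rho ^+ 2).
rewrite (_ : c * rho ^+ 2 / 2 = c * rho / 2 * rho) in H; last by rewrite expr2; ring.
have {H} : peval F xs + dir1 (ev xs) (coords v) F + c * rho / 2 * rho
    <= peval F (xs + v).
  apply: H => t /andP[t0 t1]; rewrite -vrho; apply: HF.
  rewrite addrC addKr sqnormZ vrho ler_piMl ?sqr_ge0//.
  by rewrite expr_le1.
move: D; set a := dir1 _ _ _; set p := peval F xs; set q := peval F _.
move=> aD le2; lra.
Qed.

Lemma constrained_minimizer F g xs (gam : 'I_n -> R) (c rho eta : R) :
  0 < rho -> 0 < c -> n%:R * eta < c * rho / 2 -> 0 <= eta ->
  sosconvex F -> (forall k, sosconvex (g k)) -> feasible g xs ->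
  (forall y, sqnorm (coords (y - xs)) <= rho ^+ 2 ->
    forall w, c * sqnorm w <= dir2 (ev y) w F) ->
  (forall i, `|peval (mderiv i F) xs - gam i| <= eta) ->
  (forall y, feasible g y -> 0 <= \sum_i gam i * (y - xs) 0 i) ->
  exists2 xp, unique_minimizer (peval F) (feasible g) xp &
    sqnorm (coords (xp - xs)) < rho ^+ 2.
Proof.
move=> rho0 c0 neta eta0 cF cg Cxs HF Hg kkt.
(* A far point is pulled back onto the sphere by t = rho / |y - xs|; the strict growth there extends
   to y by convexity along the segment. *)
have far y : feasible g y -> rho ^+ 2 <= sqnorm (coords (y - xs)) ->
    peval F xs < peval F y.
  move=> Cy; set s := sqnorm _ => rs.
  have s0 : 0 < s by apply: lt_le_trans rs; rewrite exprn_gt0.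
  pose t := rho / Num.sqrt s.
  have ss0 : 0 < Num.sqrt s by rewrite sqrtr_gt0.
  have t0 : 0 < t by rewrite divr_gt0.
  have t1 : t <= 1.
    rewrite ler_pdivrMr// mul1r -(@ler_pXn2r _ 2)// ?nnegrE ?(ltW rho0) ?(ltW ss0)//.
    by rewrite sqr_sqrtr// ltW.
  have : peval F xs < peval F (xs + t *: (y - xs)).
    apply: growth_of_hessian neta eta0 HF Hg _ _ => //.
      by rewrite sqnormZ -/s exprMn exprVn sqr_sqrtr ?(ltW s0)// mulfVK// gt_eqF.
    rewrite (_ : \sum_i _ = t * \sum_i gam i * (y - xs) 0 i).
      by apply: mulr_ge0; [exact: ltW|exact: kkt].
    by rewrite mulr_sumr; apply: eq_bigr => i _; rewrite [in LHS]mxE mulrCA.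
  move=> H; have := sosconvex_convex F xs y t cF.
  rewrite t1 (ltW t0) => /(_ isT) H2.
  have : t * peval F xs < t * peval F y by lra.
  by rewrite ltr_pM2l.
pose X := feasible g `&` [set y | sqnorm (coords (y - xs)) <= rho ^+ 2].
have Xxs : X xs.
  split => //=; rewrite subrr /sqnorm big1 ?sqr_ge0// => i _.
  by rewrite mxE expr2 mulr0.
have coX : compact X.
  apply: bounded_closed_compact.
    exists (`|xs| + rho); split => [|M HM y [_ /= yrho]]; first exact: num_real.
    apply: le_trans (ltW HM); rewrite -{1}(subrK xs y) addrC.
    apply: le_trans (ler_normD _ _) _; rewrite lerD2l.
    by apply: norm_le_sqnorm => //; exact: ltW.
  apply: closedI; first exact: feasible_closed.
  apply: (closed_preimage _ _ (fun y => sqnorm (coords (y - xs))) [set x | x <= rho ^+ 2]).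
    exact: sqnorm_continuous.
  exact: closed_le.
have [|xp] := compact_EVT_min (ex_intro _ xs Xxs) coX (f := peval F).
  by apply: continuous_subspaceT; exact: peval_continuous.
rewrite inE => -[Cxp _] minX.
have xpxs : peval F xp <= peval F xs by apply: minX; rewrite inE.
have min y : feasible g y -> peval F xp <= peval F y.
  move=> Cy; have [yr|/ltW ry] := leP (sqnorm (coords (y - xs))) (rho ^+ 2).
    by apply: minX; rewrite inE.
  exact: le_trans xpxs (ltW (far _ Cy ry)).
have near_xs y : minimizer (peval F) (feasible g) y ->
    sqnorm (coords (y - xs)) < rho ^+ 2.
  move=> [Cy miny]; rewrite ltNge; apply/negP => /(far _ Cy).
  by rewrite ltNge miny.
have minxp : minimizer (peval F) (feasible g) xp by split.
exists xp; last exact: near_xs.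
split => // y miny; have [Cy yle] := miny.
have ry := near_xs _ miny; have rxp := near_xs _ minxp.
(* Expanding F at the midpoint w towards both minimizers cancels the gradient terms: F(y) + F(xp) >=
   2 F(w) + c |h|^2, while F(w) is at least the minimum, so h = 0. *)
pose w := xp + 2^-1 *: (y - xp).
have Cw : feasible g w by apply: feasible_convex => //; lra.
pose h := 2^-1 *: (y - xp).
have yE : y = w + h by rewrite /w /h; apply/rowP => i; rewrite !mxE; field.
have xpE : xp = w + (- h) by rewrite /w /h addrK.
have seg (a : R) : - 1 <= a <= 1 -> sqnorm (coords (w + a *: h - xs)) <= rho ^+ 2.
  move=> /andP[a1 a2].
  have -> : w + a *: h - xs = ((1 + a) / 2) *: (y - xs) + ((1 - a) / 2) *: (xp - xs).
    by rewrite /w /h; apply/rowP => i; rewrite !mxE; field.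
  pose b := (1 + a) / 2; have b0 : 0 <= b by rewrite /b; lra.
  have b1 : b <= 1 by rewrite /b; lra.
  have -> : (1 - a) / 2 = 1 - b by rewrite /b; field.
  rewrite -/b; have : sqnorm (coords (b *: (y - xs) + (1 - b) *: (xp - xs)))
      <= b * sqnorm (coords (y - xs)) + (1 - b) * sqnorm (coords (xp - xs)).
    rewrite /sqnorm !mulr_sumr -big_split; apply: ler_sum => i _ /=.
    set p := (y - xs) 0 i; set q := (xp - xs) 0 i.
    have -> : (b *: (y - xs) + (1 - b) *: (xp - xs)) 0 i = b * p + (1 - b) * q.
      by rewrite /p /q !mxE.
    rewrite -subr_ge0 (_ : _ - _ = b * (1 - b) * (p - q) ^+ 2); last by ring.
    by rewrite mulr_ge0 ?sqr_ge0// mulr_ge0// subr_ge0.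
  have : b * sqnorm (coords (y - xs)) <= b * rho ^+ 2 by rewrite ler_wpM2l// ltW.
  have : (1 - b) * sqnorm (coords (xp - xs)) <= (1 - b) * rho ^+ 2.
    by rewrite ler_wpM2l ?subr_ge0// ltW.
  lra.
have Hy := peval_second_order F w h (c * sqnorm (coords h)).
have Hxp := peval_second_order F w (- h) (c * sqnorm (coords h)).
rewrite -yE in Hy; rewrite -xpE in Hxp.
have nh : (fun i => (- h) 0 i) = (fun i => -1 * h 0 i).
  by apply/funext => i; rewrite mxE mulN1r.
have {}Hxp : peval F w + dir1 (ev w) (coords (- h)) F + c * sqnorm (coords h) / 2
    <= peval F xp.
  apply: Hxp => t t01; rewrite (_ : sqnorm (coords h) = sqnorm (coords (- h))).
    rewrite scalerN -scaleNr; apply/HF/seg; lra.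
  by rewrite -[- h]scaleN1r (sqnormZ (- 1) h) sqrrN expr1n mul1r.
have {}Hy : peval F w + dir1 (ev w) (coords h) F + c * sqnorm (coords h) / 2
    <= peval F y.
  by apply: Hy => t t01; apply/HF/seg; lra.
rewrite nh dir1Zv in Hxp.
have := min _ Cw; have := yle _ Cxp; have := min _ Cy => h1 h2 h3.
have : c * sqnorm (coords h) <= 0 by lra.
rewrite pmulr_rle0// => hle.
have h0 : h = 0 by apply: sqnorm_eq0; apply/eqP; rewrite eq_le hle sqnorm_ge0.
by rewrite yE [in RHS]xpE h0 oppr0.
Qed.

(** The sign conditions on u hold on a whole ball, because the mean value theorem evaluates
    derivatives at unknown points of the path xp + t u. The slack constraint i survives small t by
    continuity. *)
Lemma active_at_minimizer F g xs xp u (rho : R) i :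
  minimizer (peval F) (feasible g) xp -> sqnorm (coords (xp - xs)) < rho ^+ 2 ->
  (forall y, sqnorm (coords (y - xs)) < rho ^+ 2 -> [/\ dir1 (ev y) (coords u) F < 0,
     forall k, k \notin active g xs -> peval (g k) y < 0 &
     forall k, k \in active g xs -> k != i -> dir1 (ev y) (coords u) (g k) < 0]) ->
  peval (g i) xp = 0.
Proof.
move=> [Cxp minxp] rxp H; apply/eqP; rewrite eq_le Cxp /= leNgt; apply/negP => gi0.
pose path (t : R) := xp + t *: u.
have cpath : continuous path.
  move=> t; apply: (@continuousD _ _ _ (cst xp) (fun t : R => t *: u)).
    exact: cst_continuous.
  exact: scalel_continuous.
have path0 : path 0 = xp by rewrite /path scale0r addr0.
have near1 : \forall t \near (0 : R), sqnorm (coords (path t - xs)) < rho ^+ 2.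
  have c1 := @continuous_comp _ _ _ path (fun y => sqnorm (coords (y - xs))) 0
    (cpath 0) (sqnorm_continuous xs _).
  by apply: (cvgr_lt _ c1); rewrite /= path0.
have near2 : \forall t \near (0 : R), peval (g i) (path t) < 0.
  have c2 := @continuous_comp _ _ _ path (peval (g i)) 0
    (cpath 0) (peval_continuous (g i) _).
  by apply: (cvgr_lt _ c2); rewrite /= path0.
have near12 : \forall t \near (0 : R),
    sqnorm (coords (path t - xs)) < rho ^+ 2 /\ peval (g i) (path t) < 0.
  exact: filterI near1 near2.
have /nbhs_ballP[dl /= dl0 Hdl] := near12.
pose t := dl / 2; have t0 : 0 < t by rewrite divr_gt0.
have inball s : 0 <= s <= t -> ball (0 : R) dl s.
  move=> /andP[s0 st]; rewrite -ball_normE /ball_/= sub0r normrN ger0_norm//.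
  by rewrite (le_lt_trans st)// /t; lra.
have small s : 0 < s < t -> sqnorm (coords (path s - xs)) < rho ^+ 2.
  by move=> /andP[s0 st]; have [] := Hdl s (inball s _); rewrite ?ltW.
have [rt git] : sqnorm (coords (path t - xs)) < rho ^+ 2 /\ peval (g i) (path t) < 0.
  by apply: Hdl; apply: inball; rewrite lexx ltW.
have Cpt : feasible g (path t).
  move=> k; have [kA|kA] := boolP (k \in active g xs); last first.
    by have [_ /(_ _ kA) /ltW] := H _ rt.
  have [->|ki] := eqVneq k i; first exact: ltW.
  have [s st ->] := peval_mvt (g k) xp u t t0.
  have [_ _ /(_ _ kA ki) dk] := H _ (small s st).
  have := Cxp k; have : t * dir1 (ev (path s)) (coords u) (g k) < 0 by rewrite pmulr_rlt0.
  rewrite -/(path s); lra.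
have := minxp _ Cpt; rewrite leNgt => /negP; apply.
have [s st ->] := peval_mvt F xp u t t0.
have [dF _ _] := H _ (small s st).
by rewrite -/(path s) gtrDl pmulr_rlt0.
Qed.

(** A free family has dual coordinate functionals; u represents the combination of them with values
    c_k. *)
Lemma licq_direction g xs (c : 'I_m -> R) : licq g xs ->
  exists u, forall k, k \in active g xs -> dir1 (ev xs) (coords u) (g k) = c k.
Proof.
move=> freeX; pose grads := [seq pgrad (g k) xs | k in active g xs].
pose X := in_tuple grads.
pose cs := [seq c k | k in active g xs].
pose l (w : 'rV[R]_n) : R := \sum_(j < size grads) nth 0 cs j * coord X j w.
exists (\row_i l (delta_mx 0 i)) => k kA.
have -> : dir1 (ev xs) (coords (\row_i l (delta_mx 0 i))) (g k) = l (pgrad (g k) xs).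
  rewrite [pgrad _ _ in RHS]row_sum_delta /l.
  under [RHS]eq_bigr do rewrite linear_sum mulr_sumr.
  rewrite exchange_big; apply: eq_bigr => i _ /=.
  rewrite !mxE mulr_sumr; apply: eq_bigr => j _.
  by rewrite linearZ mulrCA.
have kE : k \in enum (active g xs) by rewrite mem_enum.
have kX : (index k (enum (active g xs)) < size grads)%N.
  by rewrite size_map index_mem.
have Xk : pgrad (g k) xs = X`_(Ordinal kX).
  by rewrite (nth_map k) ?index_mem// nth_index.
rewrite /l (bigD1 (Ordinal kX))//= Xk coord_free// eqxx mulr1 big1 ?addr0.
  by rewrite (nth_map k) ?index_mem// nth_index.
by move=> j jk; rewrite coord_free// eq_sym (negbTE jk) mulr0.
Qed.

End ConstrainedMinimizer.

(** * First-order consequences of the KKT conditions *)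

Section KKT.
Context {R : realType} {n m : nat}.
Variables (f : 'rV[R]_n -> R) (g : 'I_m -> mpoly n R) (xs : 'rV[R]_n) (lam : 'I_m -> R).
Hypothesis lam_ge0 : forall i, 0 <= lam i.
Hypothesis stationary : grad f xs + \sum_i lam i *: pgrad (g i) xs = 0.
Hypothesis slackness : forall i, lam i * peval (g i) xs = 0.

Local Notation ev x := (meval (fun i => x 0 i)).
Local Notation coords u := (fun i => u 0 i).

Lemma grad_multipliers (v : 'rV[R]_n) : \sum_i grad f xs 0 i * v 0 i =
  - \sum_k lam k * dir1 (ev xs) (coords v) (g k).
Proof.
transitivity (\sum_i - ((\sum_k lam k * peval (mderiv i (g k)) xs) * v 0 i)).
  apply: eq_bigr => i _; rewrite -mulNr; congr (_ * _).
  have /(congr1 (fun w : 'rV[R]_n => w 0 i)) := stationary.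
  rewrite [LHS]mxE summxE [RHS]mxE => /eqP; rewrite addr_eq0 => /eqP ->.
  by congr (- _); apply: eq_bigr => k _; rewrite !mxE.
rewrite sumrN; congr (- _); under eq_bigr do rewrite mulr_suml.
rewrite exchange_big; apply: eq_bigr => k _; rewrite mulr_sumr.
by apply: eq_bigr => i _; rewrite mulrA.
Qed.

(** Convexity bounds <grad g_k, y - xs> by g_k(y) - g_k(xs); after multiplication by lam_k this is
    lam_k g_k(y) <= 0 by complementarity. *)
Lemma kkt_variational : (forall k, sosconvex (g k)) -> forall y, feasible g y ->
  0 <= \sum_i grad f xs 0 i * (y - xs) 0 i.
Proof.
move=> cg y Cy; rewrite grad_multipliers oppr_ge0; apply: sumr_le0 => k _.
apply: (@le_trans _ _ (lam k * (peval (g k) y - peval (g k) xs))).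
  rewrite ler_wpM2l// lerBrDl; exact: sosconvex_grad.
by rewrite mulrBr slackness subr0 mulr_ge0_le0// ; exact: Cy.
Qed.

(* u i increases the i-th constraint; it decreases f to first order because
   <grad f, u i> = - \sum_k lam k <grad g_k, u i> and lam i > 0. *)
Lemma kkt_directions : licq g xs -> (forall i, i \in active g xs -> 0 < lam i) ->
  exists u : 'I_m -> 'rV[R]_n, forall i, i \in active g xs ->
    (forall k, k \in active g xs -> k != i -> dir1 (ev xs) (coords (u i)) (g k) < 0)
    /\ \sum_j grad f xs 0 j * u i 0 j <= -1.
Proof.
move=> hlicq strict.
suff H i : exists u : 'rV[R]_n, i \in active g xs ->
    (forall k, k \in active g xs -> k != i -> dir1 (ev xs) (coords u) (g k) < 0)
    /\ \sum_j grad f xs 0 j * u 0 j <= -1.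
  by have [u uP] := choice H; exists u.
have [iA|_] := boolP (i \in active g xs); last by exists 0.
pose L := \sum_k lam k; have L0 : 0 <= L by exact: sumr_ge0.
have L1 : 0 < 1 + L by lra.
(* Constraint i contributes lam_i c_i = 2, and the other active ones at least - L / (1 + L) > -1
   altogether, so f decreases at rate at least 1. *)
pose c k := if k == i then 2 / lam i else - (1 + L)^-1.
have [u uc] := licq_direction g xs c hlicq; exists u => _; split => [k kA /negbTE ki|].
  by rewrite uc// /c ki oppr_lt0 invr_gt0.
have lam_i := strict i iA.
rewrite grad_multipliers lerNl opprK (bigD1 i)//= uc// /c eqxx mulrCA divff ?gt_eqF//.
rewrite mulr1 -lerBlDl.
have -> : 1 - 2 = - 1 :> R by lra.
rewrite -[_ <= _]lerN2 opprK -sumrN.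
apply: (@le_trans _ _ (\sum_(k | k != i) lam k / (1 + L))); last first.
  rewrite -mulr_suml ler_pdivrMr// mul1r /L [X in _ <= _ + X](bigD1 i)//=.
  by rewrite addrA lerDr; lra.
apply: ler_sum => k ki; have [kA|kA] := boolP (k \in active g xs).
  by rewrite uc// /c (negbTE ki) mulrN opprK.
(* Off the active set nothing is known about the derivative of g_k, but its multiplier is zero. *)
have /eqP := slackness k; rewrite mulf_eq0; move: kA; rewrite inE => /negbTE ->.
by rewrite orbF => /eqP ->; rewrite !mul0r oppr0.
Qed.

End KKT.

(** * Choice of the radii and stability of the active set *)

Theorem theorem5p9 (R : realType) (n m d d' : nat)
  (hd : (2 <= d)%N) (hd' : smallest_even_gt d d')
  (f : 'rV[R]_n -> R) (hf : Cd d f) (hfconv : strongly_convex f)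
  (g : 'I_m -> mpoly n R) (hg : forall i, sosconvex (g i))
  (hint : interior (feasible g) !=set0)
  (xs : 'rV[R]_n) (hxs : unique_minimizer f (feasible g) xs)
  (hlicq : licq g xs)
  (lam : 'I_m -> R) (hlam : forall i, 0 <= lam i)
  (hstat : grad f xs + \sum_i lam i *: pgrad (g i) xs = 0)
  (hcs : forall i, lam i * peval (g i) xs = 0)
  (hscs : forall i, i \in active g xs -> 0 < lam i) :
  exists2 r : R, 0 < r &
    forall x : 'rV[R]_n, enorm (x - xs) <= r ->
      exists2 t : R, is_tmin f d d' x t &
      exists2 xp : 'rV[R]_n,
        unique_minimizer (peval (psi f d d' x t)) (feasible g) xp &
        active g xp = active g xs.
Proof.
have [dd' even_d' _] := hd'; have [cf _] := hf; have [mu mu0 psdf] := hfconv.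
have [[Cxs _] _] := hxs.
have d'half : d' = d'./2.*2 by rewrite even_halfK.
(* d' is even and exceeds d >= 2, so it is at least 4. *)
have [e d'E] : exists e, d'./2 = e.+2 by exists (d'./2 - 2)%N; lia.
have [K K0 HK] : exists2 K, 0 <= K & \forall x \near xs, hess_dominated f d e mu K x.
  by apply: taylor_hess_sos => //; lia.
pose gam i := grad f xs 0 i.
have [u uP] := kkt_directions f g xs lam hlam hstat hcs hlicq hscs.
have kkt := kkt_variational f g xs lam hlam hstat hcs hg.
have nearI : \forall y \near xs, forall k, k \notin active g xs -> peval (g k) y < 0.
  apply: (@filter_forall _ _
    (fun k y => k \notin active g xs -> peval (g k) y < 0) (nbhs xs)) => k.
  have [kA|kA] := boolP (k \in active g xs); first by near=> y.
  have gk0 : peval (g k) xs < 0.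
    by rewrite lt_neqAle Cxs andbT; move: kA; rewrite inE.
  by apply: filterS (cvgr_lt _ (peval_continuous (g k) xs) _ gk0) => y yk _.
have nearA : \forall y \near xs, forall i k, i \in active g xs -> k \in active g xs ->
    k != i -> dir1 (meval (fun j => (y : 'rV[R]_n) 0 j)) (fun j => u i 0 j) (g k) < 0.
  pose P i k (y : 'rV[R]_n) := i \in active g xs -> k \in active g xs -> k != i ->
    dir1 (meval (fun j => y 0 j)) (fun j => u i 0 j) (g k) < 0.
  apply: (@filter_forall _ _ (fun i y => forall k, P i k y) (nbhs xs)) => i.
  apply: (@filter_forall _ _ (P i) (nbhs xs)) => k; rewrite /P.
  have [iA|iA] := boolP (i \in active g xs); last by near=> y.
  have [kA|kA] := boolP (k \in active g xs); last by near=> y.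
  have [->|ki] := eqVneq k i; first by near=> y.
  have [/(_ _ kA ki) uk _] := uP i iA.
  by apply: filterS (cvgr_lt _ (dir1_continuous (g k) (fun j => u i 0 j) xs) _ uk) => y yk _.
have /nbhs_ballP[d0 /= d00 H0] := HK.
have /nbhs_ballP[d1 /= d10 H1] := nearI.
have /nbhs_ballP[d2 /= d20 H2] := nearA.
pose U := \sum_i \sum_j `|u i 0 j|.
have U0 : 0 <= U by apply: sumr_ge0 => i _; exact: sumr_ge0.
have Ule i : \sum_j `|u i 0 j| <= U.
  rewrite /U (bigD1 i)//= lerDl; apply: sumr_ge0 => k _; exact: sumr_ge0.
(* Then eta1 * U <= 1 / 2: replacing grad f(xs) by the gradient of the model keeps every slope along
   u_i below - 1 / 2. *)
pose eta1 := (2 * (1 + U))^-1.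
have eta10 : 0 < eta1 by rewrite invr_gt0; lra.
have [d3 d30 H3] := psi_grad_near f d d' e d'E xs K eta1 (ltnW hd) eta10 cf.
(* For x and y within rho of [xs], s = |y - x|^2 is at most 4 rho^2 <= 2 rho <= 1, so K s^(e+1) <= 2
   K rho <= mu / 4, which leaves the modulus mu / 2 - mu / 4. The halved radii turn weak bounds into
   strict ones. *)
pose rho := Num.min 2^-1 (Num.min (mu / (8 * (K + 1)))
  (Num.min (d1 / 2) (Num.min (d2 / 2) (d3 / 2)))).
have K8 : 0 < 8 * (K + 1) by lra.
have rho0 : 0 < rho.
  by rewrite !lt_min; apply/and5P; split; rewrite ?divr_gt0 ?invr_gt0.
have : rho <= rho by []; rewrite {2}/rho !le_min => /and5P[rho1 rhoK rd1 rd2 rd3].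
clearbody rho.
(* Chosen after rho to satisfy n eta2 < (mu / 4) rho / 2, the condition of [constrained_minimizer]
   for the modulus mu / 4. *)
pose eta2 := mu / 4 * rho / (4 * (n%:R + 1)).
have n0 : 0 <= n%:R :> R by [].
have eta20 : 0 < eta2 by rewrite divr_gt0 ?mulr_gt0 ?divr_gt0//; lra.
have [d4 d40 H4] := psi_grad_near f d d' e d'E xs K eta2 (ltnW hd) eta20 cf.
pose r := Num.min rho (Num.min (d0 / 2) (Num.min (d3 / 2) (d4 / 2))).
have r0 : 0 < r.
  by rewrite !lt_min; apply/and4P; split => //; rewrite divr_gt0.
have : r <= r by []; rewrite {2}/r !le_min => /and4P[rrho rd0 rd3' rd4].
clearbody r.
exists r => // x xr.
(* The radius r is Euclidean, whereas the neighborhoods above are balls of the sup norm, which is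
   the smaller of the two. *)
have sxr : sqnorm (fun i => (x - xs) 0 i) <= r ^+ 2.
  by rewrite sqnorm_enorm ler_pXn2r ?nnegrE ?sqrtr_ge0// ltW.
have nxr : `|x - xs| <= r by apply: norm_le_sqnorm => //; exact: ltW.
have domx : hess_dominated f d e mu K x.
  by apply: H0; rewrite -ball_normE /ball_/= distrC (le_lt_trans nxr)//; lra.
have [t tmin tK] := exists_tmin f d d' e d'E mu K x (ltW mu0) K0 domx.
have [[t0 St] _] := tmin.
exists t => //; set F := psi _ _ _ _ _ in St *.
have HF y : sqnorm (fun i => (y - xs) 0 i) <= rho ^+ 2 ->
    forall w, mu / 4 * sqnorm w <= dir2 (meval (fun i => y 0 i)) w F.
  move=> yr w; apply: le_trans (psi_hess_lower f d d' e d'E mu K x t y w t0 domx).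
  apply: ler_wpM2r; first exact: sqnorm_ge0.
  set s := sqnorm _; have s0 : 0 <= s by exact: sqnorm_ge0.
  have s4 : s <= 4 * rho ^+ 2.
    have := sqnorm_half_sum (y - xs) (-1 *: (x - xs)).
    rewrite sqnormZ sqrrN expr1n mul1r (_ : (y - xs) + -1 *: (x - xs) = y - x).
      have r2 : r ^+ 2 <= rho ^+ 2 by rewrite ler_pXn2r ?nnegrE ?(ltW r0) ?(ltW rho0).
      rewrite -/s; lra.
    by rewrite scaleN1r opprB addrA subrK.
  have rho2 : rho ^+ 2 <= 2^-1 * rho by rewrite expr2 ler_wpM2r// ltW.
  have s1 : s <= 1 by lra.
  have se : s ^+ e.+1 <= s by rewrite exprS ler_piMr// exprn_ile1.
  have Ks : K * s ^+ e.+1 <= K * (2 * rho) by apply: ler_wpM2l => //; lra.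
  have : rho * (8 * (K + 1)) <= mu by rewrite -ler_pdivlMr.
  lra.
have c0 : 0 < mu / 4 by rewrite divr_gt0.
have neta : n%:R * eta2 < mu / 4 * rho / 2.
  rewrite /eta2 mulrA ltr_pdivrMr; last lra.
  have a0 : 0 < mu / 4 * rho by rewrite mulr_gt0.
  have na0 := mulr_ge0 n0 (ltW a0); lra.
have HG i : `|peval (mderiv i F) xs - gam i| <= eta2.
  apply: H4; last by rewrite t0.
    by rewrite (le_lt_trans nxr)//; lra.
  by rewrite subrr normr0.
have [xp umin xpr] := constrained_minimizer F g xs gam (mu / 4) rho eta2
  rho0 c0 neta (ltW eta20) St hg Cxs HF HG kkt.
exists xp => //; have [minxp _] := umin; have [Cxp _] := minxp.
have inball y : sqnorm (fun i => (y - xs) 0 i) < rho ^+ 2 -> `|xs - y| <= rho.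
  by move=> yr; rewrite distrC; apply: norm_le_sqnorm; exact: ltW.
apply/setP => i; have [iA|iA] := boolP (i \in active g xs); last first.
  rewrite inE; apply/negbTE; rewrite lt_eqF//.
  by apply: H1 iA; rewrite -ball_normE /ball_/=; have := inball _ xpr; lra.
rewrite inE; apply/eqP.
apply: (active_at_minimizer F g xs xp (u i) rho i minxp xpr) => y yr.
have yrho := inball _ yr; split => [|k kA|k kA ki].
- have [_ gu] := uP i iA.
  have -> : dir1 (meval (fun j => y 0 j)) (fun j => u i 0 j) F
      = \sum_j gam j * u i 0 j + \sum_j (peval (mderiv j F) y - gam j) * u i 0 j.
    by rewrite -big_split; apply: eq_bigr => j _ /=; rewrite -mulrDl addrC subrK.
  have small : \sum_j (peval (mderiv j F) y - gam j) * u i 0 j <= eta1 * U.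
    apply: (@le_trans _ _ (eta1 * \sum_j `|u i 0 j|)); last by rewrite ler_wpM2l// ltW.
    rewrite mulr_sumr; apply: ler_sum => j _; apply: le_trans (ler_norm _) _.
    rewrite normrM ler_wpM2r//; apply: H3; last by rewrite t0.
      by rewrite (le_lt_trans nxr)//; lra.
    by rewrite distrC (le_lt_trans yrho)//; lra.
  have : eta1 * U <= 2^-1.
    rewrite /eta1 mulrC ler_pdivrMr; lra.
  lra.
- by apply: H1 kA; rewrite -ball_normE /ball_/=; lra.
- by apply: H2 => //; rewrite -ball_normE /ball_/=; lra.
Unshelve. all: by end_near.
Qed.
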